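(* Let $\mathbb{K}$ be any field of characteristic $0$, and let $AGL(1,\mathbb{K}) = \mathbb{K}_+ \rtimes \mathbb{K}^*$. Then $AGL(1,\mathbb{K})$ embeds, as a subgroup, into a sharply $2$-transitive group $G$ of characteristic $0$ such that $G$ (in its sharply $2$-transitive action) contains no regular normal subgroup.
   Context: $\mathbb{K}_+$ denotes the additive group of $\mathbb{K}$, $\mathbb{K}^*$ its multiplicative group, and $\mathbb{K}_+ \rtimes \mathbb{K}^*$ is the group of affine maps $x\mapsto ax+b$ ($a\in\mathbb{K}^*$, $b\in\mathbb{K}$), with $\mathbb{K}^*$ acting on $\mathbb{K}_+$ by multiplication. A permutation group $G$ acting on a set $X$ with $|X|\ge 2$ is sharply $2$-transitive if for any two pairs $(x,y)$, $(x',y')$ of distinct elements of $X$ there is exactly one $g\in G$ with $g(x)=x'$ and $g(y)=y'$. In a sharply $2$-transitive group all involutions are conjugate; the group has characteristic $2$ if involutions have no fixed point, and otherwise the product of two distinct involutions has either a fixed prime order $p$ (characteristic $p$) or infinite order (characteristic $0$). A subgroup $N$ is regular if it acts regularly (simply transitively) on $X$; the sharply $2$-transitive group is called split if it contains a regular normal subgroup. *)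

(* Defs.v *)
From mathcomp Require Import all_boot all_algebra.
Set Implicit Arguments. Unset Strict Implicit. Unset Printing Implicit Defensive.
Import GRing.Theory.
Local Open Scope ring_scope.

Definition perm_group (X : Type) (G : (X -> X) -> Prop) : Prop :=
  G id /\
  (forall g h, G g -> G h -> G (g \o h)) /\
  (forall g, G g -> exists2 h, G h & (h \o g = id /\ g \o h = id)).

Definition sharply_2_transitive (X : Type) (G : (X -> X) -> Prop) : Prop :=
  perm_group G /\
  (exists x y : X, x <> y) /\
  (forall x y x' y' : X, x <> y -> x' <> y' ->
     exists g, (G g /\ g x = x' /\ g y = y') /\
       forall g', G g' -> g' x = x' -> g' y = y' -> g' = g).

Definition involution_in (X : Type) (G : (X -> X) -> Prop) (s : X -> X) : Prop :=
  G s /\ s <> id /\ s \o s = id.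

(* Characteristic 0: involutions have fixed points (so not characteristic 2),
   and the product of two distinct involutions has infinite order. *)
Definition s2t_char0 (X : Type) (G : (X -> X) -> Prop) : Prop :=
  (forall s, involution_in G s -> exists x, s x = x) /\
  (forall s t, involution_in G s -> involution_in G t -> s <> t ->
     forall n : nat, (0 < n)%N -> iter n (s \o t) <> id).

Definition regular_normal_subgroup (X : Type) (G N : (X -> X) -> Prop) : Prop :=
  (forall n, N n -> G n) /\ perm_group N /\
  (forall g h n, G g -> G h -> h \o g = id -> N n -> N (g \o n \o h)) /\
  (forall x y : X, exists n, (N n /\ n x = y) /\
     forall n', N n' -> n' x = y -> n' = n).

(* phi : AGL(1,K) -> G (elements of AGL(1,K) written as pairs (a,b), a != 0,
   standing for x |-> a x + b) is an injective group homomorphism into G. *)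
Definition AGL1_embeds (K : fieldType) (X : Type) (G : (X -> X) -> Prop)
    (phi : K -> K -> (X -> X)) : Prop :=
  (forall a b, a != 0 -> G (phi a b)) /\
  (forall a b a' b', a != 0 -> a' != 0 ->
     phi a b \o phi a' b' = phi (a * a') (a * b' + b)) /\
  (forall a b a' b', a != 0 -> a' != 0 -> phi a b = phi a' b' ->
     a = a' /\ b = b').

(* Main.v *)
(* Write AGL(1,K) = H.  It suffices to find a group G containing H such that any
   two distinct involutions of G are simultaneously conjugate into H, such that
   h^2 <> 1 and h^g in H force g in H, and such that G <> H: then G acts sharply
   2-transitively by conjugation on its involutions.  A regular normal subgroup
   would contain every product of two involutions and be inverted by every
   involution, hence be abelian, so that a translation of H would commute with all
   of its conjugates, and malnormality would give G = H.

   G is the union of a chain starting with H.  Given a member of the chain, one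
   adjoins stable letters conjugating into H the dihedral type subgroups that
   contain the pairs of involutions not yet conjugate into H.  In the Bass-Serre
   tree of this HNN extension, two involutions s, t either fix a common vertex, and
   then are conjugate into H, or st is hyperbolic.  In the latter case the
   stabilizer of the axis of st acts faithfully on it, hence embeds in Isom(Z) and so
   in H; two such stabilizers share only involutions unless the axes agree.  The
   stabilizers of representatives of the axes are the subgroups treated at the next
   step. *)
From HB Require Import structures.
Require Import Defs.
From mathcomp Require Import all_boot all_order all_algebra.
From mathcomp Require Import boolp zify ring.
Set Implicit Arguments. Unset Strict Implicit. Unset Printing Implicit Defensive.
Import Order.TTheory GRing.Theory Num.Theory.
Local Open Scope group_scope.

(** * Trees as Lyndon length functions *)

(* [l g] is the distance from a base vertex o of a tree to g o, and [cp g h] the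
   length of the common part of the paths from o to g o and h o.  Vertices g o are
   represented by g, so equality of vertices reads [dist _ _ = 0].  The last field
   excludes inversions of edges. *)
Record lyndon_length (G : groupType) (l : G -> nat) (cp : G -> G -> nat) : Prop := {
  lyndon1 : l 1%g = 0%N;
  lyndon_cp : forall g h, (l (g^-1 * h)%g + (cp g h).*2 = l g + l h)%N;
  lyndon_ultra : forall g h k, (minn (cp g h) (cp h k) <= cp g k)%N;
  lyndon_prefix : forall g k, (k <= l g)%N ->
    exists p, l p = k /\ l (p^-1 * g) = (l g - k)%N;
  lyndon_flip : forall g, l g = 1%N -> l (g * g) <> 0%N }.

Section Tree.
Variables (G : groupType) (l : G -> nat) (cp : G -> G -> nat).
Hypothesis lP : lyndon_length l cp.
Implicit Types (x y z u v w g e s t : G).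

Definition dist x y := l (x^-1 * y).

Lemma lengthV x : l x^-1 = l x.
Proof.
have := lyndon_cp lP x 1; have := lyndon_cp lP x^-1 1.
by rewrite invgK !mulg1 (lyndon1 lP); lia.
Qed.

Lemma distM g x y : dist (g * x) (g * y) = dist x y.
Proof. by rewrite /dist invgM -mulgA mulKg. Qed.

Lemma distMl g x y : dist (g * x) y = dist x (g^-1 * y).
Proof. by rewrite -(distM g^-1) mulKg. Qed.

Lemma distC x y : dist x y = dist y x.
Proof. by rewrite /dist -lengthV invgM invgK. Qed.

Lemma distxx x : dist x x = 0%N.
Proof. by rewrite /dist mulVg (lyndon1 lP). Qed.

Lemma dist_cp x y : (dist x y + (cp x y).*2 = l x + l y)%N.
Proof. exact: lyndon_cp. Qed.

Lemma cpC x y : cp x y = cp y x.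
Proof. by have := dist_cp x y; have := dist_cp y x; rewrite distC; lia. Qed.

(** Zero-hyperbolicity, the metric form of being a tree: up to the lengths of the end points,
    distances are values of [cp], and four instances of its ultrametric inequality suffice. *)
Lemma four_point x y z w :
  (dist x y + dist z w <= maxn (dist x z + dist y w) (dist x w + dist y z))%N.
Proof.
have := (dist_cp x y, dist_cp z w, dist_cp x z, dist_cp y w, dist_cp x w, dist_cp y z).
move=> [[[[[]]]]].
have U := lyndon_ultra lP.
have := (U x z y, U x w y, U z x w, U z y w) => -[[[]]].
rewrite (cpC z x) (cpC z y) (cpC w y).
move: (dist x y) (dist z w) (dist x z) (dist y w) (dist x w) (dist y z).
move: (cp x y) (cp z w) (cp x z) (cp y w) (cp x w) (cp y z) => *.
by lia.
Qed.

Lemma dist_tri y x z : (dist x z <= dist x y + dist y z)%N.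
Proof. by have := four_point x z y y; rewrite distxx (distC z y); lia. Qed.

(** A tree is bipartite: each distance has the parity of the sum of the lengths of its end
    points. *)
Lemma dist_odd x y z : ~~ odd (dist x y + dist y z + dist x z).
Proof.
have := (dist_cp x y, dist_cp y z, dist_cp x z) => -[[]].
by move: (cp _ _) (cp _ _) (cp _ _) (dist _ _) (dist _ _) (dist _ _) => *; lia.
Qed.

Lemma dist0_l x y z : dist x y = 0%N -> dist x z = dist y z.
Proof. by move=> xy; have := (dist_tri y x z, dist_tri x y z) => -[]; rewrite (distC y x); lia. Qed.

Lemma dist0_r x y z : dist x y = 0%N -> dist z x = dist z y.
Proof. by rewrite (distC z x) (distC z y); exact: dist0_l. Qed.

Lemma geodesic_point u v k : (k <= dist u v)%N ->
  exists2 m, dist u m = k & dist m v = (dist u v - k)%N.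
Proof.
move=> kd; have [p [pk pd]] := lyndon_prefix lP kd.
exists (u * p); first by rewrite /dist mulKg.
by rewrite distMl.
Qed.

Lemma geodesic_close u v x y : (dist u x + dist x v = dist u v)%N ->
  (dist u y + dist y v = dist u v)%N ->
  (dist u x <= dist u y)%N -> dist x y = (dist u y - dist u x)%N.
Proof.
move=> ux uy le; have := four_point u v x y; have := dist_tri x u y.
by rewrite (distC v x) (distC v y); lia.
Qed.

(* A path that does not backtrack along [y z] is geodesic. *)
Lemma dist_glue x y z w : dist x z = (dist x y + dist y z)%N ->
  dist y w = (dist y z + dist z w)%N -> (0 < dist y z)%N ->
  dist x w = (dist x y + dist y z + dist z w)%N.
Proof.
move=> xz yw yz; have := four_point x z y w; have := dist_tri y x w.
by rewrite (distC z y); lia.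
Qed.

(** * Elliptic and hyperbolic elements *)

Definition elliptic g := exists v, dist v (g * v) = 0%N.

Definition hyperbolic_at v g :=
  (0 < dist v (g * v))%N /\ dist v (g * (g * v)) = (dist v (g * v)).*2.

(** Take [v] of minimal displacement L > 0 and suppose that the path through [v], [g * v],
    [g * (g * v)] backtracks. If L = 1, an edge is inverted. Otherwise the last vertex [m] before
    [g * v] is also the first vertex after it, and [m] has displacement L - 2. *)
Lemma elliptic_or_hyperbolic g : elliptic g \/ exists v, hyperbolic_at v g.
Proof.
have [v vmin] : exists v, forall u, (dist v (g * v) <= dist u (g * u))%N.
  pose P n := `[< exists v, dist v (g * v) = n >].
  have exP : exists n, P n by exists (dist 1 (g * 1)); apply/asboolP; exists 1.
  case: (ex_minnP exP) => n /asboolP[v <-] nmin; exists v => u.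
  by apply: nmin; apply/asboolP; exists u.
case: (posnP (dist v (g * v))) => [v0|vpos]; first by left; exists v.
right; exists v; split=> //; apply/eqP; case: eqP => // neq.
set L := dist v (g * v) in vpos neq vmin.
have gv : dist (g * v) (g * (g * v)) = L by rewrite distM.
have D2 : (dist v (g * (g * v)) <= L.*2 - 2)%N.
  have := dist_tri (g * v) v (g * (g * v)); have := dist_odd v (g * v) (g * (g * v)).
  by rewrite gv -/L; lia.
have [L1|L2] : L = 1%N \/ (2 <= L)%N by lia.
  have l1 : l (v^-1 * (g * v)) = 1%N by rewrite -L1.
  case: (lyndon_flip lP l1); move: D2; rewrite L1 /dist => D2.
  by have -> : v^-1 * (g * v) * (v^-1 * (g * v)) = v^-1 * (g * (g * v));
     [rewrite -!mulgA mulVKg | lia].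
have [m vm mgv] : exists2 m, dist v m = (L - 1)%N & dist m (g * v) = 1%N.
  have [|m mv mgv] := @geodesic_point v (g * v) (L - 1); first by rewrite -/L; lia.
  by exists m => //; rewrite mgv -/L; lia.
have gm : dist (g * v) (g * m) = (L - 1)%N by rewrite distM.
have mggv : dist (g * m) (g * (g * v)) = 1%N by rewrite distM.
have [m' gvm' m'ggv] : exists2 m', dist (g * v) m' = 1%N &
    dist m' (g * (g * v)) = (L - 1)%N.
  have [|m' m'1 m'2] := @geodesic_point (g * v) (g * (g * v)) 1; first by rewrite gv; lia.
  by exists m' => //; rewrite m'2 gv.
have mm' : dist m m' = 0%N.
  have vm' : dist v m' = (L - 1)%N.
    have := dist_odd v (g * v) m'; rewrite -/L gvm' => par.
    have := dist_tri (g * v) v m'; rewrite -/L gvm' => up.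
    have lo := dist_tri m' v (g * v); rewrite -/L (distC m') gvm' in lo.
    (* By parity [m'] has distance L - 1 or L + 1 from [v]; with L + 1 the two segments would glue
       to a geodesic of length 2L, against [neq]. *)
    have glue := @dist_glue v (g * v) m' (g * (g * v)).
    rewrite -/L gv gvm' m'ggv in glue.
    by have [|] : dist v m' = (L - 1)%N \/ dist v m' = (L + 1)%N; lia.
  have := @geodesic_close (g * v) v m m'.
  rewrite (distC (g * v) m) mgv (distC m v) vm (distC (g * v) v) -/L gvm'.
  by rewrite (distC m' v) vm' => ->; lia.
have := vmin m; rewrite (dist0_l _ mm').
have := @geodesic_close (g * v) (g * (g * v)) m' (g * m).
by rewrite gv gvm' m'ggv gm mggv => ->; lia.
Qed.


Lemma involution_elliptic s : s * s = 1 -> elliptic s.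
Proof.
move=> ss; case: (elliptic_or_hyperbolic s) => // -[v []].
by rewrite mulgA ss mul1g distxx; lia.
Qed.

(** If [s * t] fixes [v], then [s * v] and [t * v] are the same vertex, so both involutions exchange
    the ends of one segment and fix its midpoint. The midpoint is a vertex because [s] fixes some
    [u], equidistant from both ends, which makes the length even. *)
Lemma involutions_fix_common s t : s * s = 1 -> t * t = 1 -> elliptic (s * t) ->
  exists v, dist v (s * v) = 0%N /\ dist v (t * v) = 0%N.
Proof.
move=> ss tt [v stv].
have sV : s^-1 = s by apply: mulg1_eq.
have tV : t^-1 = t by apply: mulg1_eq.
have svtv : dist (s * v) (t * v) = 0%N by rewrite distMl sV mulgA.
have [u su] := involution_elliptic ss.
have ev : ~~ odd (dist v (s * v)).
  have := dist_odd v u (s * v).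
  by rewrite (dist0_l _ su) distM (distC u v); lia.
have [M vM Msv] := @geodesic_point v (s * v) (dist v (s * v))./2 (ltac:(lia)).
exists M; set k := (dist v (s * v))./2 in vM.
have dE : dist v (s * v) = k.*2 by rewrite /k; lia.
have Msv' : dist M (s * v) = k by rewrite Msv dE; lia.
have sM : dist v (s * M) = k by rewrite distC distMl sV.
have sM' : dist (s * M) (s * v) = k by rewrite distM distC.
have tM : dist v (t * M) = k by rewrite distC distMl tV -(dist0_r _ svtv).
have tM' : dist (t * M) (s * v) = k by rewrite (dist0_r _ svtv) distM distC.
split.
  by rewrite (@geodesic_close v (s * v)); lia.
by rewrite (@geodesic_close v (s * v)); lia.
Qed.

Lemma hyperbolic_iter v g n : hyperbolic_at v g ->
  dist v (g ^+ n * v) = (n * dist v (g * v))%N.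
Proof.
move=> [pos dbl].
suff: (dist v (g ^+ n * v)%g = n * dist v (g * v)%g)%N /\ 
      (dist v (g ^+ n.+1 * v)%g = n.+1 * dist v (g * v)%g)%N by case.
elim: n => [|n [IH1 IH2]]; first by rewrite expg0 mul1g distxx expg1 mul1n.
split=> //.
have E1 : g ^+ n.+1 * v = g ^+ n * (g * v) by rewrite expgSr -mulgA.
have E2 : g ^+ n.+2 * v = g ^+ n * (g * (g * v)) by rewrite 2!expgSr -!mulgA.
have E3 : dist (g ^+ n.+1 * v) (g ^+ n.+2 * v) = dist v (g * v).
  by rewrite expgSr -mulgA E2 !distM.
have := @dist_glue v (g ^+ n * v) (g ^+ n.+1 * v) (g ^+ n.+2 * v).
rewrite E3 IH1 IH2 {1 2 3 4}E1 distM E2 distM -E2 dbl => -> //; lia.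
Qed.

(** * Lines, axes and translations along them *)

Definition line (a : int -> G) := forall i j, dist (a i) (a j) = `|(i - j)%R|%N.

Definition is_sign (eps : int) := (eps == 1%R) || (eps == - 1%R)%R.

(* [g] carries the line [a] to the line [b] through the isometry i |-> eps i + k. *)
Definition maps g (a b : int -> G) (eps k : int) :=
  forall i, dist (g * a i) (b (eps * i + k)%R) = 0%N.

Lemma maps1 a : maps 1 a a 1 0.
Proof. by move=> i; rewrite mul1g mul1r addr0 distxx. Qed.

Lemma maps_mul g h a b c eps eps' k k' : maps g a b eps k -> maps h b c eps' k' ->
  maps (h * g) a c (eps' * eps) (eps' * k + k').
Proof.
move=> ga hb i; rewrite -mulgA.
have := ga i; rewrite -(distM h) => /dist0_l ->.
by have := hb (eps * i + k)%R; rewrite mulrDr mulrA addrA.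
Qed.

Lemma maps_inv g a b eps k : is_sign eps -> maps g a b eps k ->
  maps g^-1 b a eps (- (eps * k)).
Proof.
move=> eps1 ga i; rewrite distMl invgK distC.
have := ga (eps * i - eps * k)%R; rewrite mulrBr !mulrA.
have -> : (eps * eps = 1)%R by case/orP: eps1 => /eqP ->.
by rewrite !mul1r subrK.
Qed.

Lemma maps_uniq g a b eps k eps' k' : line b -> maps g a b eps k -> maps g a b eps' k' ->
  eps = eps' /\ k = k'.
Proof.
move=> bl h1 h2.
have E i : (eps * i + k = eps' * i + k')%R.
  have := h2 i; rewrite (dist0_l _ (h1 i)) bl; lia.
by have := E 0%R; have := E 1%R; rewrite !mulr0 !mulr1 !add0r => + kk; rewrite kk => /addIr ->.
Qed.

(** The axis is the union of the nested geodesics from [g ^- N * v] to [g ^+ N * v]. *)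
Lemma axis_exists v g : hyperbolic_at v g ->
  exists a c, [/\ line a, maps g a a 1 c & c <> 0%R].
Proof.
move=> hyp; set L := dist v (g * v).
have Lpos : (0 < L)%N by case: hyp.
have itL n : dist v (g ^+ n * v) = (n * L)%N by exact: hyperbolic_iter.
(* [On N i x] gives [x] the coordinate [i] on the N-th geodesic, with origin at its middle [v];
   coordinates persist when N grows. *)
pose On (N : nat) (i : int) x := Posz (dist (g ^- N * v) x) = (Posz (N * L)%N + i)%R /\ Posz (dist x (g ^+ N * v)) = (Posz (N * L)%N - i)%R.
have ends M N : dist (g ^- M * v) (g ^+ N * v) = ((M + N) * L)%N.
  by rewrite distMl invgK mulgA -expgnDr itL.
have Oex N i : (`|i| <= N)%N -> exists x, On N i x.
  move=> iN.
  have h : (`|(Posz (N * L)%N + i)%R| <= dist (g ^- N * v) (g ^+ N * v))%N.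
    by rewrite ends; nia.
  have [m m1 m2] := geodesic_point h; exists m; split; rewrite ?m1 ?m2 ?ends; nia.
have Omon M N i x : On N i x -> On (M + N)%N i x.
  move=> [o1 o2].
  have e1 : dist (g ^- (M + N)%N * v) (g ^- N * v) = (M * L)%N.
    rewrite distMl invgK mulgA expgnDr mulgK; exact: itL.
  have e2 : dist (g ^+ N * v) (g ^+ (M + N)%N * v) = (M * L)%N.
    by rewrite addnC expgnDr -mulgA distM itL.
  have t1 := dist_tri (g ^- N * v) (g ^- (M + N)%N * v) x.
  have t2 := dist_tri (g ^+ N * v) x (g ^+ (M + N)%N * v).
  have t3 := dist_tri x (g ^- (M + N)%N * v) (g ^+ (M + N)%N * v).
  rewrite e1 in t1; rewrite e2 in t2; rewrite ends in t3.
  by split; nia.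
have Odist N i j x y : On N i x -> On N j y -> dist x y = `|(i - j)%R|%N.
  move=> [x1 x2] [y1 y2]; have en := ends N N.
  have [ij|ij] := leP i j.
    by rewrite (@geodesic_close (g ^- N * v) (g ^+ N * v)); lia.
  by rewrite distC (@geodesic_close (g ^- N * v) (g ^+ N * v)); lia.
have [a aP] := choice (fun i : int => Oex `|i|%N i (leqnn _)).
have aN i N : (`|i| <= N)%N -> On N i (a i).
  by move=> iN; rewrite -(subnK iN); exact: Omon.
exists a, (Posz L); split; last by lia.
- by move=> i j; apply: (@Odist (maxn `|i| `|j|)); apply: aN; lia.
- move=> i; rewrite mul1r.
  have [N Ni] : exists N, (`|i| + L <= N)%N by exists (`|i| + L)%N.
  have [_ o2] := aN i N (ltac:(lia)); have [o1 _] := aN i N.+2 (ltac:(lia)).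
  (* Applying [g] turns the ends with exponents -(N + 2) and N into those with exponents -(N + 1)
     and N + 1, hence the use of two different geodesics for [a i]. *)
  have gai : On N.+1 (i + Posz L)%R (g * a i).
    split.
      have -> : g ^- N.+1 * v = g * (g ^- N.+2 * v).
        by rewrite (expgSr g N.+1) invgM mulgA mulVKg.
      by rewrite distM; nia.
    rewrite expgS -mulgA distM o2. lia.
  by rewrite (Odist _ _ _ _ _ gai (aN _ N.+1 _)); lia.
Qed.

(** Take [a j] nearest to [v]. Parity forbids a tie with its neighbours, so the path from [v] to
    [a j] continues along the line in either direction without backtracking. *)
Lemma line_projection a v : line a ->
  exists j, forall k, dist v (a k) = (dist v (a j) + `|(k - j)%R|)%N.
Proof.
move=> al.
have [j jmin] : exists j, forall k, (dist v (a j) <= dist v (a k))%N.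
  pose P n := `[< exists j, dist v (a j) = n >].
  have exP : exists n, P n by exists (dist v (a 0%R)); apply/asboolP; exists 0%R.
  case: (ex_minnP exP) => n /asboolP[j <-] nmin; exists j => k.
  by apply: nmin; apply/asboolP; exists k.
exists j => k.
have side (eps : int) : is_sign eps -> (0 < eps * (k - j))%R ->
    dist v (a k) = (dist v (a j) + `|(k - j)%R|)%N.
  move=> eps1 pos; have jk := al j k; have := al (j + eps)%R k.
  have j1 := al j (j + eps)%R; have le := jmin (j + eps)%R.
  have par := dist_odd v (a j) (a (j + eps)%R).
  have up := dist_tri (a j) v (a (j + eps)%R).
  have glue := @dist_glue v (a j) (a (j + eps)%R) (a k).
  by case/orP: eps1 pos => /eqP eE; rewrite eE in j1 le par up glue *; lia.
have [lt|gt|->] := ltrgtP k j.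
- by apply: (side (-1)%R) => //; lia.
- by apply: (side 1%R) => //; lia.
- by rewrite subrr addn0.
Qed.

(* The same [j], the projection of [v] to the line, serves all translations [e]. *)
Lemma displacement a v : line a ->
  exists j, forall e c, c <> 0%R -> maps e a a 1 c ->
    dist v (e * v) = ((dist v (a j)).*2 + `|c|)%N.
Proof.
move=> al; have [j jP] := line_projection v al; exists j => e c c0 ea.
have eaj : dist (e * a j) (a (j + c)%R) = 0%N by have := ea j; rewrite mul1r.
have eaj' : dist (a j) (e * a (j - c)%R) = 0%N.
  by have := ea (j - c)%R; rewrite mul1r subrK distC.
have h1 : dist v (e * a j) = (dist v (a j) + `|c|)%N.
  by rewrite (dist0_r _ eaj) jP addrAC subrr add0r.
have h2 : dist (a j) (e * v) = (dist v (a j) + `|c|)%N.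
  by rewrite (dist0_l _ eaj') distM distC jP addrAC subrr add0r abszN.
have h3 : dist (e * a j) (e * v) = dist v (a j) by rewrite distM distC.
have h4 : dist (a j) (e * a j) = `|c|%N.
  by rewrite (dist0_r _ eaj) al opprD addNKr abszN.
have := four_point v (e * a j) (a j) (e * v); have := dist_tri (a j) v (e * v).
by rewrite h1 h2 h3 (distC (e * a j)) h4; lia.
Qed.

Lemma maps_exp e a c n : maps e a a 1 c -> maps (e ^+ n) a a 1 (c * Posz n).
Proof.
move=> ea; elim: n => [|n IH]; first by rewrite mulr0; exact: maps1.
by rewrite expgS intS mulrDr mulr1 addrC -[(c * n)%R]mul1r -{1}(mul1r 1%R); exact: maps_mul IH ea.
Qed.

Lemma shift_not_elliptic a e c : line a -> maps e a a 1 c -> c <> 0%R -> ~ elliptic e.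
Proof.
by move=> al ea c0 [v]; have [j /(_ e c c0 ea) ->] := displacement v al; lia.
Qed.

Lemma shift_dist a e c i : line a -> maps e a a 1 c -> dist (a i) (e * a i) = `|c|%N.
Proof.
by move=> al ea; rewrite (dist0_r _ (ea i)) al mul1r opprD addNKr abszN.
Qed.

Lemma int_isometry (f : int -> int) :
  (forall i j, `|(f i - f j)%R|%N = `|(i - j)%R|%N) ->
  exists eps k, is_sign eps /\ forall i, f i = (eps * i + k)%R.
Proof.
move=> fP; exists (f 1 - f 0)%R, (f 0%R); have := fP 1%R 0%R => f10.
have [E|E] : (f 1 - f 0 = 1 \/ f 1 - f 0 = -1)%R by lia.
  by split=> [|i]; rewrite E //; have := fP i 0%R; have := fP i 1%R; lia.
by split=> [|i]; rewrite E //; have := fP i 0%R; have := fP i 1%R; lia.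
Qed.

(** Let d be the distance from [b i] to [a]. The displacements of [b i] under [e] and its square
    give |c'| = 2d + |c| and 2|c'| = 2d + 2|c|, so d = 0. Thus [b] lies on [a], and comparing the
    two parametrizations yields an isometry of the integers. *)
Lemma axis_unique e a b c c' : line a -> line b ->
  maps e a a 1 c -> maps e b b 1 c' -> c <> 0%R -> c' <> 0%R ->
  exists eps k, is_sign eps /\ maps 1 b a eps k.
Proof.
move=> al bl ea eb c0 c'0.
have on_a i : exists j, dist (b i) (a j) = 0%N.
  have [j jP] := displacement (b i) al; exists j.
  have c20 : (c * Posz 2 <> 0)%R by lia.
  have := jP _ _ c0 ea; have := jP _ _ c20 (maps_exp 2 ea).
  by rewrite (shift_dist i bl eb) (shift_dist i bl (maps_exp 2 eb)); lia.
have [f fP] := choice on_a.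
have [|eps [k [sg fE]]] := @int_isometry f.
  by move=> i j; rewrite -al -bl -(dist0_l _ (fP i)) -(dist0_r _ (fP j)).
by exists eps, k; split=> // i; rewrite mul1g -fE.
Qed.

End Tree.

(** * HNN extensions with several stable letters *)

(* [x] and [bar x] are the two orientations of a loop in a graph of groups with one
   vertex; the HNN extension imposes [a * x = x * th x a] for [a] in [A x]. *)
Record edge_system (G : groupType) (L : Type) (bar : L -> L) (A : L -> pred G)
    (th : L -> G -> G) : Prop := {
  es_barK : involutive bar;
  es_bar_neq : forall x, bar x <> x;
  es_1 : forall x, A x 1%g;
  es_M : forall x g h, A x g -> A x h -> A x (g * h)%g;
  es_V : forall x g, A x g -> A x g^-1%g;
  es_th : forall x g, A x g -> A (bar x) (th x g);
  es_thM : forall x g h, A x g -> A x h -> th x (g * h)%g = (th x g * th x h)%g;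
  es_thK : forall x g, A x g -> th (bar x) (th x g) = g }.

Section HNN.
Variables (G : groupType) (L : choiceType) (bar : L -> L) (A : L -> pred G).
Variable th : L -> G -> G.
Hypothesis es : edge_system bar A th.
Implicit Types (g h a r : G) (x y : L).

Let barK : involutive bar := es_barK es.
Let A1 x : A x 1 := es_1 es x.

Lemma es_mull x g h : A x g -> A x (g * h) = A x h.
Proof.
move=> xg; apply/idP/idP => [hg|xh]; last exact: (es_M es).
by rewrite -(mulKg g h); apply: (es_M es) => //; exact: (es_V es).
Qed.

Lemma es_inv x g : A x g^-1 = A x g.
Proof. by apply/idP/idP => /(es_V es) //; rewrite invgK. Qed.

Lemma es_th1 x : th x 1 = 1.
Proof. by apply: (mulgI (th x 1)); rewrite -(es_thM es) // !mulg1. Qed.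

(** * Coset representatives and reduced words *)

Lemma coset_ex x g : exists h, A x (g^-1 * h).
Proof. by exists g; rewrite mulVg. Qed.

(** [xchoose] depends only on the predicate, hence only on the coset of [g]; the case distinction
    makes 1 the representative of the subgroup itself, as normal forms require. *)
Definition rep x g := if A x g then 1 else xchoose (coset_ex x g).

Lemma rep_coset x g : A x ((rep x g)^-1 * g).
Proof.
rewrite /rep; case: ifP => [xg|_]; first by rewrite invg1 mul1g.
by rewrite -es_inv invgM invgK; exact: (xchooseP (coset_ex x g)).
Qed.

Lemma rep_eq x g h : A x (g^-1 * h) -> rep x g = rep x h.
Proof.
move=> xgh; have E k : A x (g^-1 * k) = A x (h^-1 * k).
  by rewrite -(es_mull (h^-1 * k) xgh) -mulgA mulVKg.
have gh : A x g = A x h by rewrite -es_inv -(mulg1 g^-1) E mulg1 es_inv.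
rewrite /rep gh; case: ifP => // _; apply: eq_xchoose => k; exact: E.
Qed.

Lemma rep_mulr x g a : A x a -> rep x (g * a) = rep x g.
Proof. by move=> xa; apply/esym/rep_eq; rewrite mulKg. Qed.

Lemma rep_rep x g : rep x (rep x g) = rep x g.
Proof. exact: rep_eq (rep_coset x g). Qed.

Lemma rep_eq1 x g : (rep x g == 1) = A x g.
Proof.
apply/eqP/idP => [r1|xg]; last by rewrite /rep xg.
by have := rep_coset x g; rewrite r1 invg1 mul1g.
Qed.

Lemma rep1 x : rep x 1 = 1.
Proof. by apply/eqP; rewrite rep_eq1. Qed.

Lemma rep_mull_eq x g r r' : rep x r = r -> rep x r' = r' ->
  (rep x (g * r) == rep x (g * r')) = (r == r').
Proof.
move=> rr rr'; apply/eqP/eqP => [|-> //] E.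
rewrite -rr -rr'; apply: rep_eq.
have := rep_coset x (g * r'); rewrite -E => h1.
have := rep_coset x (g * r); rewrite -es_inv => h2.
have := es_M es h2 h1.
by rewrite invgM invgK -mulgA mulVKg invgM -mulgA mulKg.
Qed.

(* [(r1, x1) :: ... :: (rn, xn)] with last entry [h] stands for
   [r1 x1 ... rn xn h]; reducedness forbids the factors [x 1 (bar x)]. *)
Local Notation word := (seq (G * L)).

Definition starts_with x (w : word) := if w is (r, y) :: _ then (r == 1) && (y == x) else false.

Fixpoint reduced (w : word) :=
  if w is (r, x) :: w' then [&& rep x r == r, ~~ starts_with (bar x) w' & reduced w'] else true.

(** Left multiplication by [g] pushed through a word: writing [g * r] as r' a with r' a
    representative and a in [A x], the relation gives g r x = r' x (th x a). [lact] collects the new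
    word, [lcarry] the element that leaves it on the right. *)
Fixpoint lact g (w : word) : word :=
  if w is (r, x) :: w' then
    (rep x (g * r), x) :: lact (th x ((rep x (g * r))^-1 * (g * r))) w' else [::].

Fixpoint lcarry g (w : word) : G :=
  if w is (r, x) :: w' then lcarry (th x ((rep x (g * r))^-1 * (g * r))) w' else g.

Definition xact x (w : word) : word :=
  if starts_with (bar x) w then behead w else (1, x) :: w.

Lemma size_lact g w : size (lact g w) = size w.
Proof. by elim: w g => //= -[r x] w IH g /=; rewrite IH. Qed.

Lemma starts_with_lact x a w : reduced w -> A x a ->
  starts_with x (lact a w) = starts_with x w.
Proof.
case: w => //= -[r y] w /= /and3P[/eqP rr _ _] xa.
case: (y =P x) xa => [<- ya|_ _]; last by rewrite !andbF.
by rewrite rep_eq1 es_mull // -rep_eq1 rr.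
Qed.

Lemma reduced_lact g w : reduced w -> reduced (lact g w).
Proof.
elim: w g => //= -[r x] w IH g /= /and3P[/eqP rr nb red].
rewrite rep_rep eqxx IH // andbT /= starts_with_lact //.
exact: (es_th es) (rep_coset _ _).
Qed.

Lemma lact1 w : reduced w -> lact 1 w = w.
Proof.
elim: w => //= -[r x] w IH /= /and3P[/eqP rr nb red].
by rewrite mul1g rr mulVg es_th1 IH.
Qed.

Lemma lcarry1 w : reduced w -> lcarry 1 w = 1.
Proof.
elim: w => //= -[r x] w IH /= /and3P[/eqP rr nb red].
by rewrite mul1g rr mulVg es_th1 IH.
Qed.

Lemma rep_carry x g h r : let r' := rep x (h * r) in
  rep x (g * r') = rep x (g * h * r) /\
  th x ((rep x (g * h * r))^-1 * (g * h * r)) =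
  th x ((rep x (g * r'))^-1 * (g * r')) * th x (r'^-1 * (h * r)).
Proof.
move=> r'; have E : rep x (g * r') = rep x (g * h * r).
  have -> : g * h * r = g * r' * (r'^-1 * (h * r)) by rewrite -!mulgA mulVKg.
  by rewrite [RHS]rep_mulr //; exact: rep_coset.
have h1 : A x ((rep x (g * r'))^-1 * (g * r')) by exact: rep_coset.
have h2 : A x (r'^-1 * (h * r)) by exact: rep_coset.
by split=> //; rewrite -(es_thM es h1 h2) E -!mulgA mulVKg.
Qed.

Lemma lactM g h w : lact (g * h) w = lact g (lact h w).
Proof.
elim: w g h => //= -[r x] w IH g h /=.
by have [-> ->] := rep_carry x g h r; rewrite IH.
Qed.

Lemma lcarryM g h w : lcarry (g * h) w = lcarry g (lact h w) * lcarry h w.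
Proof.
elim: w g h => //= -[r x] w IH g h /=.
by have [-> ->] := rep_carry x g h r; rewrite IH.
Qed.

Lemma reduced_xact x w : reduced w -> reduced (xact x w).
Proof.
rewrite /xact; case: ifP => [|nb red]; last by rewrite /= rep1 eqxx nb.
by case: w => //= -[r y] w _ /and3P[].
Qed.

Lemma xactK x w : reduced w -> xact (bar x) (xact x w) = w.
Proof.
rewrite {2}/xact; case: ifP => [|nb red]; last by rewrite /xact /= barK !eqxx.
case: w => //= -[r y] w /= /andP[/eqP -> /eqP ->]; rewrite barK.
by case/and3P => _ nb _; rewrite /xact barK (negbTE nb).
Qed.

(** The defining relation of the HNN extension, verified for the actions on words. *)
Lemma lact_xact x a w : reduced w -> A x a ->
  lact a (xact x w) = xact x (lact (th x a) w) /\
  lcarry a (xact x w) = lcarry (th x a) w.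
Proof.
move=> red xa; have a' := es_th es xa.
rewrite /xact starts_with_lact //; case: ifP => [|_].
  case: w red => //= -[r y] w /= /and3P[_ _ _] /andP[/eqP -> /eqP ->].
  have -> : rep (bar x) (th x a * 1) = 1 by apply/eqP; rewrite rep_eq1 mulg1.
  by rewrite invg1 mul1g mulg1 (es_thK es).
rewrite /= mulg1; have -> : rep x a = 1 by apply/eqP; rewrite rep_eq1.
by rewrite invg1 mul1g.
Qed.

Lemma lact_cons r x w : reduced ((r, x) :: w) -> lact r (xact x w) = (r, x) :: w /\
  lcarry r (xact x w) = 1.
Proof.
move=> /= /and3P[/eqP rr nb red]; rewrite /xact (negbTE nb) /= mulg1 rr mulVg es_th1.
by rewrite lact1 // lcarry1.
Qed.

(** * Multiplication of normal forms *)

Implicit Types (w : word) (p q : word * G).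

Definition gact g p := (lact g p.1, lcarry g p.1 * p.2).
Definition tact x p := (xact x p.1, p.2).

Fixpoint wact w p :=
  if w is (r, x) :: w' then gact r (tact x (wact w' p)) else p.

(** Van der Waerden's method: [p] acts on the normal form [q] one letter at a time, so no
    concatenated word has to be reduced. *)
Definition pmul p q := wact p.1 (gact p.2 q).

Fixpoint winv w p :=
  if w is (r, x) :: w' then winv w' (tact (bar x) (gact r^-1 p)) else p.

Definition pinv p := gact p.2^-1 (winv p.1 ([::], 1)).

Lemma gactM g h p : gact (g * h) p = gact g (gact h p).
Proof. by rewrite /gact /= lactM lcarryM mulgA. Qed.

Lemma gact1 p : reduced p.1 -> gact 1 p = p.
Proof. by case: p => w h /= red; rewrite /gact /= lact1 // lcarry1 // mul1g. Qed.

Lemma gactK g p : reduced p.1 -> gact g^-1 (gact g p) = p.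
Proof. by move=> red; rewrite -gactM mulVg gact1. Qed.

Lemma tactK x p : reduced p.1 -> tact (bar x) (tact x p) = p.
Proof. by case: p => w h red; rewrite /tact /= xactK. Qed.

Lemma gact_tact x a p : reduced p.1 -> A x a ->
  gact a (tact x p) = tact x (gact (th x a) p).
Proof. by move=> red xa; rewrite /gact /tact /=; have [-> ->] := lact_xact red xa. Qed.

Lemma gact_cons r x w h : reduced ((r, x) :: w) ->
  gact r (tact x (w, h)) = ((r, x) :: w, h).
Proof. by move=> red; rewrite /gact /=; have [-> ->] := lact_cons red; rewrite mul1g. Qed.

Lemma reduced_gact g p : reduced p.1 -> reduced (gact g p).1.
Proof. exact: reduced_lact. Qed.

Lemma reduced_tact x p : reduced p.1 -> reduced (tact x p).1.
Proof. exact: reduced_xact. Qed.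

Lemma reduced_wact w p : reduced p.1 -> reduced (wact w p).1.
Proof. by move=> red; elim: w => //= -[r x] w IH; exact/reduced_gact/reduced_tact. Qed.

Lemma reduced_winv w p : reduced p.1 -> reduced (winv w p).1.
Proof. by elim: w p => //= -[r x] w IH p red; exact/IH/reduced_tact/reduced_gact. Qed.

Lemma reduced_pmul p q : reduced q.1 -> reduced (pmul p q).1.
Proof. by move=> red; exact/reduced_wact/reduced_gact. Qed.

Lemma reduced_pinv p : reduced (pinv p).1.
Proof. exact/reduced_gact/reduced_winv. Qed.

Lemma pmul_gact g p q : reduced q.1 -> pmul (gact g p) q = gact g (pmul p q).
Proof.
move=> red; rewrite /pmul /= gactM; have := reduced_gact p.2 red.
elim: p.1 g (gact _ q) => //= -[r x] w IH g u redu /=.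
rewrite IH // -gact_tact; [|exact: reduced_wact|exact: rep_coset].
by rewrite -!gactM mulVKg.
Qed.

Lemma pmul_tact x p q : reduced q.1 -> pmul (tact x p) q = tact x (pmul p q).
Proof.
move=> red; rewrite /pmul /tact /=; have := reduced_gact p.2 red.
case: p => w h /=; rewrite /xact; case: ifP => [sw|_] redp; last first.
  by rewrite /= gact1 //; exact/reduced_tact/reduced_wact.
case: w sw => //= -[r y] w /andP[/eqP -> /eqP ->].
rewrite gact1; last exact/reduced_tact/reduced_wact.
rewrite -[RHS]/(tact x (tact (bar x) (wact w (gact h q)))) -{1}(barK x) tactK //.
exact: reduced_wact.
Qed.

(** The actions of single elements and letters commute with right multiplication by [s]; induct on
    the letters of [p]. *)
Lemma pmulA p q s : reduced q.1 -> reduced s.1 -> pmul p (pmul q s) = pmul (pmul p q) s.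
Proof.
move=> redq reds; rewrite -[LHS]/(wact p.1 (gact p.2 (pmul q s))) -(pmul_gact _ _ reds).
rewrite -[pmul p q]/(wact p.1 (gact p.2 q)); have := reduced_gact p.2 redq.
elim: p.1 (gact _ q) => //= -[r x] w IH u redu.
by rewrite IH // -(pmul_tact _ _ reds) -(pmul_gact _ _ reds).
Qed.

Lemma pmul1p p : reduced p.1 -> pmul ([::], 1) p = p.
Proof. exact: gact1. Qed.

Lemma pmulp1 p : reduced p.1 -> pmul p ([::], 1) = p.
Proof.
case: p => w h /= red; rewrite /pmul /gact /= mulg1.
elim: w red => //= -[r x] w IH red; rewrite IH; first exact: gact_cons.
by case/and3P: red.
Qed.

Lemma pmulVp p : reduced p.1 -> pmul (pinv p) p = ([::], 1).
Proof.
move=> redp; rewrite /pinv pmul_gact //.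
have -> u : pmul (winv p.1 u) p = winv p.1 (pmul u p).
  elim: p.1 u => //= -[r x] w IH u.
  by rewrite IH pmul_tact // pmul_gact.
rewrite pmul1p //; case: p redp => w h /= red.
have -> : winv w (w, h) = ([::], h).
  elim: w red => //= -[r x] w IH red.
  have red' : reduced w by case/and3P: red.
  by rewrite -(gact_cons _ red) gactK ?tactK ?IH //; exact: reduced_tact.
by rewrite /gact /= mulVg.
Qed.

Lemma pmulpV p : reduced p.1 -> pmul p (pinv p) = ([::], 1).
Proof.
move=> redp; have redi := reduced_pinv p; have redii := reduced_pinv (pinv p).
have redpi := reduced_pmul p redi.
rewrite -[LHS](pmul1p redpi) -{1}(pmulVp redi) -pmulA // (pmulA _ redp redi).
by rewrite (pmulVp redp) (pmul1p redi) pmulVp.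
Qed.

Record hnn := Hnn { hnn_val : word * G; hnn_red : reduced hnn_val.1 }.
HB.instance Definition _ := [isSub for hnn_val].
HB.instance Definition _ := [Choice of hnn by <:].

Definition hnn_mul (u v : hnn) := Hnn (reduced_pmul (hnn_val u) (hnn_red v)).
Definition hnn_one := @Hnn ([::], 1) isT.
Definition hnn_inv (u : hnn) := Hnn (reduced_pinv (hnn_val u)).

Lemma hnn_mulA : associative hnn_mul.
Proof. by move=> u v w; apply: val_inj => /=; apply: pmulA; exact: hnn_red. Qed.
Lemma hnn_mul1g : left_id hnn_one hnn_mul.
Proof. by move=> u; apply: val_inj; apply: pmul1p; exact: hnn_red. Qed.
Lemma hnn_mulg1 : right_id hnn_one hnn_mul.
Proof. by move=> u; apply: val_inj; apply: pmulp1; exact: hnn_red. Qed.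
Lemma hnn_mulVg : left_inverse hnn_one hnn_inv hnn_mul.
Proof. by move=> u; apply: val_inj; apply: pmulVp; exact: hnn_red. Qed.
Lemma hnn_mulgV : right_inverse hnn_one hnn_inv hnn_mul.
Proof. by move=> u; apply: val_inj; apply: pmulpV; exact: hnn_red. Qed.

HB.instance Definition _ :=
  isGroup.Build hnn hnn_mulA hnn_mul1g hnn_mulg1 hnn_mulVg hnn_mulgV.

Definition base g : hnn := @Hnn ([::], g) isT.

Lemma baseM : {morph base : g h / g * h}.
Proof. by move=> g h; apply: val_inj. Qed.

Lemma base_inj : injective base.
Proof. by move=> g h /(congr1 hnn_val) []. Qed.

Lemma reduced_letter x : reduced [:: (1, x)].
Proof. by rewrite /= rep1 eqxx. Qed.

Definition letter x : hnn := @Hnn ([:: (1, x)], 1) (reduced_letter x).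

Lemma base_letter x a : A x a -> base a * letter x = letter x * base (th x a).
Proof.
move=> xa; apply: val_inj => /=; rewrite /pmul /gact /tact /= /xact /= !mulg1.
have -> : rep x a = 1 by apply/eqP; rewrite rep_eq1.
rewrite !(invg1, mul1g, mulg1, rep1, es_th1). by rewrite gact1 //; exact: reduced_letter.
Qed.

(** * The length function of the Bass-Serre tree *)

Definition len (u : hnn) := size (hnn_val u).1.

Lemma len_base u : len u = 0%N <-> exists g, u = base g.
Proof.
split=> [|[g ->] //]; case: u => -[[|? ?] h] // red _.
by exists h; apply: val_inj.
Qed.

Fixpoint lcp (T : eqType) (s t : seq T) : nat :=
  if s is a :: s' then if t is b :: t' then if a == b then (lcp s' t').+1 else 0 else 0
  else 0.

Lemma lcp_sizel (T : eqType) (s t : seq T) : (lcp s t <= size s)%N.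
Proof. by elim: s t => [|a s IH] [|b t] //=; case: ifP => // _; apply: IH. Qed.

Lemma lcp_sizer (T : eqType) (s t : seq T) : (lcp s t <= size t)%N.
Proof. by elim: s t => [|a s IH] [|b t] //=; case: ifP => // _; apply: IH. Qed.

Lemma lcp_ultra (T : eqType) (s t u : seq T) : (minn (lcp s t) (lcp t u) <= lcp s u)%N.
Proof.
elim: s t u => [|a s IH] [|b t] [|c u] //=; rewrite ?minn0 ?min0n //.
case: eqP => [->|_]; last by rewrite min0n.
by case: eqP => // _; rewrite minnSS ltnS.
Qed.

Lemma lcp_take (T : eqType) k (s : seq T) : (k <= size s)%N -> lcp (take k s) s = k.
Proof. by elim: s k => [|a s IH] [|k] //= ks; rewrite eqxx IH. Qed.

Lemma lcp_eq (T : eqType) (s t : seq T) : lcp s t = size s -> lcp s t = size t -> s = t.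
Proof.
elim: s t => [|a s IH] [|b t] //=; case: eqP => // -> [st] [ts].
by rewrite (IH t).
Qed.

(** Reduced words without their last entry represent the cosets of the base group, that is, the
    vertices of the Bass-Serre tree; this is the tree distance. *)
Definition wdist w w' := (size w + size w' - (lcp w w').*2)%N.

Lemma wdist_eq0 w w' : wdist w w' = 0%N -> w = w'.
Proof.
rewrite /wdist => d0; have /= h := lcp_sizel w w'; have /= h' := lcp_sizer w w'.
by apply: lcp_eq => /=; lia.
Qed.

Lemma wdist_lact g w w' : reduced w -> reduced w' -> wdist (lact g w) (lact g w') = wdist w w'.
Proof.
rewrite /wdist !size_lact => red red'; congr (_ - _.*2)%N.
elim: w w' g red red' => [|[r x] w IH] [|[r' x'] w'] g //=.
move=> /and3P[/eqP rr _ red] /and3P[/eqP rr' _ red'].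
have [xx|xx] := eqVneq x x'; last first.
  by rewrite !ifF //; apply/eqP => -[_]; apply/eqP.
subst x'; rewrite !xpair_eqE !eqxx !andbT rep_mull_eq //.
by case: eqP => // ->; rewrite IH.
Qed.

Lemma lcp_starts x w w' : ~~ starts_with x w -> lcp w ((1, x) :: w') = 0%N.
Proof. by case: w => //= -[r y] w; rewrite xpair_eqE => /negbTE ->. Qed.

Lemma lcpC (T : eqType) (s t : seq T) : lcp s t = lcp t s.
Proof. by elim: s t => [|a s IH] [|b t] //=; rewrite eq_sym IH. Qed.

Lemma starts_withP x w : starts_with x w -> exists w', w = (1, x) :: w'.
Proof. by case: w => //= -[r y] w /andP[/eqP -> /eqP ->]; exists w. Qed.

Lemma wdist_xact x w w' : reduced w -> reduced w' -> wdist (xact x w) (xact x w') = wdist w w'.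
Proof.
(* If one word loses a letter and the other gains one, reducedness makes the common prefix empty
   before and after, and the changes of size cancel. *)
have mixed u v : reduced u -> starts_with (bar x) u -> ~~ starts_with (bar x) v ->
    (size (behead u) + (size v).+1 - (lcp (behead u) ((1%g, x) :: v)).*2 =
     size u + size v - (lcp u v).*2)%N.
  move=> red /starts_withP[u' uE] nv; subst u; rewrite (lcpC _ v) (lcp_starts _ nv) /=.
  move: red => /= /and3P[_ + _]; rewrite barK => nu'.
  by rewrite (lcp_starts _ nu'); lia.
rewrite /wdist /xact => red red'.
case: ifP => sw; case: ifP => sw'.
- case/starts_withP: sw => u wE; case/starts_withP: sw' => u' w'E; subst w w' => /=.
  by rewrite eqxx /=; lia.
- by rewrite /= mixed // sw'.
- by rewrite addnC lcpC [in RHS]addnC [in RHS]lcpC /= mixed // sw.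
- by rewrite /= eqxx; lia.
Qed.

Lemma wdist_mul u v v' :
  wdist (hnn_val (u * v)).1 (hnn_val (u * v')).1 = wdist (hnn_val v).1 (hnn_val v').1.
Proof.
have red := hnn_red v; have red' := hnn_red v'.
rewrite -(wdist_lact (hnn_val u).2 red red').
pose p := gact (hnn_val u).2 (hnn_val v); pose p' := gact (hnn_val u).2 (hnn_val v').
have redp : reduced p.1 by exact: reduced_gact.
have redp' : reduced p'.1 by exact: reduced_gact.
rewrite -[LHS]/(wdist (wact (hnn_val u).1 p).1 (wact (hnn_val u).1 p').1) -[RHS]/(wdist p.1 p'.1).
elim: (hnn_val u).1 => //= -[r x] w IH.
have rw := reduced_wact w redp; have rw' := reduced_wact w redp'.
rewrite -IH -[LHS]/(wdist (lact r (xact x (wact w p).1)) (lact r (xact x (wact w p').1))).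
by rewrite wdist_lact ?reduced_xact // wdist_xact.
Qed.

Lemma len_dist u v : len (u^-1 * v) = wdist (hnn_val u).1 (hnn_val v).1.
Proof. by rewrite -(wdist_mul u^-1) mulVg /wdist /= add0n subn0. Qed.

Definition common u v := lcp (hnn_val u).1 (hnn_val v).1.

Lemma hnn_lyndon : lyndon_length len common.
Proof.
split.
- by [].
- move=> u v; rewrite len_dist /wdist /len /common.
  by rewrite subnK // -addnn leq_add ?lcp_sizel ?lcp_sizer.
- by move=> u v w; exact: lcp_ultra.
- case=> -[w h] red k /= kw.
  have redk : reduced (take k w).
    elim: w k red {kw} => [|[r x] w IH] [|k] //= /and3P[-> + /IH ->]; rewrite andbT.
    by case: w {IH} => [|[r' x'] w] //; case: k.
  exists (@Hnn (take k w, 1) redk); split; first by rewrite /len /= size_takel.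
  by rewrite len_dist /wdist /= size_takel // lcp_take // -addnn subnDl.
(* In the square of r x h the two letters could cancel only if [bar x] were [x]. *)
- case=> -[[|[r x] [|]] h] red //= _; rewrite /len /= /pmul /= size_lact /xact /=.
  by case: (x =P bar x) => [/esym /(es_bar_neq es)|_] //; rewrite andbF.
Qed.

(** Length 0 of the conjugate means that [base g] fixes the vertex of [u]; what the word of [u]
    carries to the right then determines the conjugate. *)
Lemma fix_word u g : len ((base g) ^ u) = 0%N -> lact g (hnn_val u).1 = (hnn_val u).1 /\
  base g ^ u = base ((lcarry g (hnn_val u).1) ^ (hnn_val u).2).
Proof.
rewrite conjgE len_dist => d0.
have E : lact g (hnn_val u).1 = (hnn_val u).1.
  exact/esym/wdist_eq0.
split=> //; apply: (mulgI u); rewrite mulVKg; apply: val_inj.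
rewrite -[LHS]/(gact g (hnn_val u)) /gact E.
rewrite -[RHS]/(pmul (hnn_val u) ([::], lcarry g (hnn_val u).1 ^ (hnn_val u).2)).
rewrite /pmul /gact /= mulVKg.
move: (_ * _) => k; elim: (hnn_val u).1 (hnn_red u) => //= -[r x] w IH red.
by rewrite -IH; [rewrite gact_cons | case/and3P: red].
Qed.

(** Fixing a path means fixing its first edge, hence lying in a conjugate of an edge group, and then
    fixing the rest of the path. *)
Lemma fix_cons g r x w : reduced ((r, x) :: w) -> lact g ((r, x) :: w) = (r, x) :: w ->
  [/\ A x (g ^ r), lact (th x (g ^ r)) w = w &
      lcarry g ((r, x) :: w) = lcarry (th x (g ^ r)) w].
Proof.
move=> /= red [E1 E2]; rewrite E1 in E2 *; split=> //.
by have := rep_coset x (g * r); rewrite E1.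
Qed.

End HNN.

(** * Stabilizers of axes *)

Definition invol (G : groupType) (s : G) := s * s = 1 /\ s <> 1.

Lemma involV (G : groupType) (s : G) : invol s -> s^-1 = s.
Proof. by case=> ss _; exact: mulg1_eq. Qed.

Lemma involJ (G : groupType) (s g : G) : invol s -> invol (s ^ g).
Proof.
case=> ss s1; split; first by rewrite -conjMg ss conj1g.
by move/eqP; rewrite conjg_eq1 => /eqP.
Qed.

(* An embedding in [H] of the isometries i |-> eps i + k of the integers. *)
Record isom_model (H : groupType) (psi : int -> int -> H) : Prop := {
  psiM : forall eps eps' k k', is_sign eps -> is_sign eps' ->
    (psi eps k * psi eps' k')%g = psi (eps * eps')%R (eps * k' + k)%R;
  psi_inj : forall eps eps' k k', is_sign eps -> is_sign eps' ->
    psi eps k = psi eps' k' -> eps = eps' /\ k = k' }.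

Lemma is_sign1 : is_sign 1. Proof. by []. Qed.

Lemma is_signM (e e' : int) : is_sign e -> is_sign e' -> is_sign (e * e').
Proof. by case/orP => /eqP ->; case/orP => /eqP ->. Qed.

Section AxisGroups.
Variables (G H : groupType) (l : G -> nat) (cp : G -> G -> nat) (psi : int -> int -> H).
Hypothesis lP : lyndon_length l cp.
Hypothesis psiP : isom_model psi.
Hypothesis acylindrical : forall x u v, (3 <= dist l u v)%N ->
  dist l u (x * u) = 0%N -> dist l v (x * v) = 0%N -> x * x = 1.
Hypothesis not_commute : forall s t : G, invol s -> invol t -> s <> t ->
  (s * t) * (s * t) <> 1.

Local Notation line := (line l).
Local Notation maps := (maps l).
Local Notation elliptic := (elliptic l).

Lemma mapsJ e g a c : maps (e ^ g) a a 1 c ->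
  maps e (fun i => g * a i) (fun i => g * a i) 1 c.
Proof.
by move=> ea i; have := ea i; rewrite -(distM l g) conjgE -!mulgA mulVKg.
Qed.

(** Since [s] inverts [s * t], it carries the axis of [s * t] to an axis of the inverse, which is
    the same line. *)
Lemma reflection_maps s t a c : invol s -> invol t -> line a -> maps (s * t) a a 1 c ->
  c <> 0%R -> exists eps k, is_sign eps /\ maps s a a eps k.
Proof.
move=> sI tI al sta c0; have stV : (s * t)^-1 = (s * t) ^ s.
  by rewrite conjgE -mulgA mulKg invgM !involV.
have stm : maps ((s * t) ^ s) a a 1 (- (1 * c)) by rewrite -stV; exact (maps_inv lP is_sign1 sta).
have bl : line (fun i => s * a i) by move=> i j; rewrite distM.
have c1 : (- (1 * c) <> 0)%R by rewrite mul1r; lia.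
have [eps [k [sg m]]] := axis_unique lP al bl sta (mapsJ stm) c0 c1.
by exists eps, k; split=> // i; have := m i; rewrite mul1g.
Qed.

(** By acylindricity every element fixing the line pointwise squares to 1. If [g] were an
    involution, any involution u preserving the line would satisfy u g u = g, as both lie in the
    kernel and distinct involutions do not commute; then u commutes with [g], so u = g. This gives s
    = t = g, so [s * t] would not translate. *)
Lemma line_kernel s t a c g : invol s -> invol t -> line a -> maps (s * t) a a 1 c ->
  c <> 0%R -> maps g a a 1 0 -> g = 1.
Proof.
move=> sI tI al sta c0 ga.
have kerM x y : maps x a a 1 0 -> maps y a a 1 0 -> maps (x * y) a a 1 0.
  by move=> xa ya; have := maps_mul lP ya xa; rewrite !mul1r addr0.
have sq x : maps x a a 1 0 -> x * x = 1.
  move=> xa; apply: (@acylindrical x (a 0%R) (a 3)); first by rewrite al.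
    by have := xa 0%R; rewrite mulr0 (distC lP).
  by have := xa 3; rewrite mul1r addr0 (distC lP).
apply: contrapT => g1; have gI : invol g by split=> //; exact: sq.
have tst : maps (t * s) a a 1 (- (1 * c)).
  have -> : t * s = (s * t)^-1 by rewrite invgM !involV.
  exact (maps_inv lP is_sign1 sta).
have key u : invol u -> (exists eps k, is_sign eps /\ maps u a a eps k) -> u = g.
  move=> uI [eps [k [sg um]]].
  have um2 := maps_mul lP um um; rewrite (proj1 uI) in um2.
  have [e1 e2] := maps_uniq lP al um2 (maps1 lP a).
  have gu : maps (u * (g * u)) a a 1 0.
    have := maps_mul lP (maps_mul lP um ga) um.
    by rewrite !mul1r addr0 e1 e2.
  have guI : invol (u * (g * u)).
    by have := involJ u gI; rewrite conjgE involV.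
  have gguE : u * (g * u) = g.
    by apply: contrapT => /(not_commute guI gI); case; apply: sq; exact: kerM.
  apply: contrapT => /(not_commute uI gI); case.
  have -> : u * g * (u * g) = u * (g * u) * g by rewrite !mulgA.
  by rewrite gguE (proj1 gI).
have c1 : (- (1 * c) <> 0)%R by rewrite mul1r; lia.
have sg := key s sI (reflection_maps sI tI al sta c0).
have tg := key t tI (reflection_maps tI sI al tst c1).
rewrite sg tg (proj1 gI) in sta.
by have [_ /esym] := maps_uniq lP al (maps1 lP a) sta.
Qed.

Definition hyp_pair (p : G * G) :=
  [/\ invol p.1, invol p.2 & ~ elliptic (p.1 * p.2)].

Lemma axis_of p : exists a, hyp_pair p ->
  line a /\ exists2 c, maps (p.1 * p.2) a a 1 c & c <> 0%R.
Proof.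
have [[sI tI ne]|np] := pselect (hyp_pair p); last by exists (fun=> 1) => /np.
have [/ne //|[v /(axis_exists lP)[a [c [al ma c0]]]]] := elliptic_or_hyperbolic lP (p.1 * p.2).
by exists a => _; split=> //; exists c.
Qed.

(** [E p] is the stabilizer of the axis of a representative pair [p], and [phi p] its action on that
    axis, read in [H] through [psi]. Injectivity is [line_kernel]; malnormality is uniqueness of
    axes. *)
Lemma axis_groups : exists (E : G * G -> pred G) (phi : G * G -> G -> H),
  (forall p, E p 1) /\
  (forall p g h, E p g -> E p h -> E p (g * h) /\ phi p (g * h) = phi p g * phi p h) /\
  (forall p g, E p g -> E p g^-1) /\
  (forall p g h, E p g -> E p h -> phi p g = phi p h -> g = h) /\
  (forall p e, E p e -> e * e <> 1 -> ~ elliptic e) /\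
  (forall p q e g, E p e -> e * e <> 1 -> E q (e ^ g) -> p = q /\ E p g) /\
  (forall s t, invol s -> invol t -> ~ elliptic (s * t) ->
     exists g p, E p (s ^ g) /\ E p (t ^ g)).
Proof.
have [ax axP] := choice axis_of.
pose eqv p q := [/\ hyp_pair p, hyp_pair q &
  exists g eps k, is_sign eps /\ maps g (ax p) (ax q) eps k].
have eqv_refl p : hyp_pair p -> eqv p p.
  by move=> hp; split=> //; exists 1, 1%R, 0%R; split=> //; exact (maps1 lP _).
have eqv_sym p q : eqv p q -> eqv q p.
  case=> hp hq [g [eps [k [sg m]]]]; split=> //.
  by exists g^-1, eps, (- (eps * k))%R; split=> //; exact (maps_inv lP sg m).
have eqv_trans p q r : eqv p q -> eqv q r -> eqv p r.
  case=> hp hq [g [eps [k [sg m]]]] [_ hr [g' [eps' [k' [sg' m']]]]]; split=> //.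
  exists (g' * g), (eps' * eps)%R, (eps' * k + k')%R.
  by split; [exact: is_signM|exact (maps_mul lP m m')].
(* A choice of one pair in each orbit of axes. The implication in [ex] keeps the predicate inhabited
   for pairs without an axis. *)
have [canon canonP] : {canon : G * G -> G * G & forall p, hyp_pair p ->
    eqv p (canon p) /\ forall q, eqv p q -> canon p = canon q}.
  have ex p : exists q, `[< hyp_pair p >] ==> `[< eqv p q >].
    exists p; apply/implyP => /asboolP hp; apply/asboolP; exact: eqv_refl.
  exists (fun p => xchoose (ex p)) => p hp; split.
    by have /implyP := xchooseP (ex p); move=> /(_ (asboolT hp)) /asboolP.
  move=> q pq; apply: eq_xchoose => r; have hq : hyp_pair q by case: pq.
  rewrite (asboolT hp) (asboolT hq) /=; apply: asbool_equiv_eq.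
  by split; apply: eqv_trans; [exact: eqv_sym|].
(* Only the representatives [canon p = p] of the classes of axes receive a nontrivial
   group, so that groups with different indices are not conjugate. *)
pose Q p g h := (g = 1 /\ h = 1) \/ (hyp_pair p /\ canon p = p /\
  exists eps k, [/\ is_sign eps, maps g (ax p) (ax p) eps k & h = psi eps k]).
have psi1 : psi 1 0 = 1.
  by apply: (mulgI (psi 1 0)); rewrite (psiM psiP) // mulg1 mulr0 addr0 mulr1.
have kernel p g : hyp_pair p -> maps g (ax p) (ax p) 1 0 -> g = 1.
  by move=> hp; have [al [c m c0]] := axP p hp; case: hp => sI tI _; exact: line_kernel m c0.
have QM p g h g' h' : Q p g h -> Q p g' h' -> Q p (g * g') (h * h').
  move=> [[-> ->]|]; first by rewrite !mul1g.
  move=> [hp [cpp [eps [k [sg m hE]]]]] [[-> ->]|].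
    by rewrite !mulg1; right; do 2!split=> //; exists eps, k.
  move=> [_ [_ [eps' [k' [sg' m' hE']]]]]; right; do 2!split=> //.
  exists (eps * eps')%R, (eps * k' + k)%R; split; first exact: is_signM.
    exact (maps_mul lP m' m).
  by rewrite hE hE' (psiM psiP).
have QV p g h : Q p g h -> exists h', Q p g^-1 h'.
  move=> [[-> _]|[hp [cpp [eps [k [sg m hE]]]]]]; first by exists 1; left; rewrite invg1.
  exists (psi eps (- (eps * k))%R); right; do 2!split=> //; exists eps, (- (eps * k))%R.
  by split=> //; exact (maps_inv lP sg m).
have Qinj1 p g : Q p g 1 -> g = 1.
  move=> [[]//|[hp [cpp [eps [k [sg m]]]]]]; rewrite -psi1 => /(psi_inj psiP) [//|//|e0 k0].
  by apply: (kernel p) => //; rewrite e0 k0.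
have Qfun p g h h' : Q p g h -> Q p g h' -> h = h'.
  move=> [[g1 ->]|[hp [cpp [eps [k [sg m hE]]]]]] [[g2 ->]|[hp' [cpp' [eps' [k' [sg' m' hE']]]]]] //.
  - have [al _] := axP p hp'.
    rewrite g1 in m'.
    by have [e1 k1] := maps_uniq lP al (maps1 lP (ax p)) m'; rewrite hE' -e1 -k1 psi1.
  - have [al _] := axP p hp; rewrite g2 in m.
    by have [e1 k1] := maps_uniq lP al (maps1 lP (ax p)) m; rewrite hE -e1 -k1 psi1.
  - have [al _] := axP p hp.
    by have [ee kk] := maps_uniq lP al m m'; rewrite hE hE' ee kk.
have Qtotal p g : exists h, (exists h', Q p g h') -> Q p g h.
  have [[h qh]|nq] := pselect (exists h, Q p g h); first by exists h.
  by exists 1 => /nq.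
have phi_ex p : exists f : G -> H, forall g, (exists h, Q p g h) -> Q p g (f g).
  by have [f fP] := choice (Qtotal p); exists f.
have [phi phiP] := choice phi_ex.
pose E p : pred G := fun g => `[< exists h, Q p g h >].
have EQ p g : E p g -> Q p g (phi p g) by move=> /asboolP /phiP.
have QE p g h : Q p g h -> E p g by move=> q; apply/asboolP; exists h.
(* A reflection of the axis has its square in the trivial kernel, so an element with nontrivial
   square is a nonzero translation. *)
have shift p e : E p e -> e * e <> 1 -> [/\ hyp_pair p, canon p = p &
    exists2 k, maps e (ax p) (ax p) 1 k & k <> 0%R].
  move=> /EQ[[-> _]|[hp [cpp [eps [k [sg m _]]]]]] ee; first by case: ee; rewrite mulg1.
  split=> //; case/orP: sg => /eqP eE; rewrite eE in m.
    by exists k => // k0; apply: ee; rewrite k0 in m; rewrite (kernel _ _ hp m) mulg1.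
  case: ee; apply: (kernel _ _ hp); have := maps_mul lP m m.
  by rewrite mulrNN mulr1 mulN1r addNr.
exists E, phi; split; first by move=> p; apply: (QE p 1 1); left.
split.
  move=> p g h Eg Eh; have q := QM _ _ _ _ _ (EQ _ _ Eg) (EQ _ _ Eh).
  by split; [exact: QE q | exact: Qfun (EQ _ _ (QE _ _ _ q)) q].
split; first by move=> p g /EQ /QV[h q]; exact: QE q.
split.
  move=> p g h Eg Eh E12; have [h' qV] := QV _ _ _ (EQ _ _ Eh).
  have q1 := QM _ _ _ _ _ (EQ _ _ Eh) qV; rewrite mulgV in q1.
  have q1' : Q p 1 1 by left.
  have q2 := QM _ _ _ _ _ (EQ _ _ Eg) qV.
  rewrite E12 (Qfun _ _ _ _ q1 q1') in q2.
  by apply/eqP; rewrite -divg_eq1; apply/eqP; exact: Qinj1 q2.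
split.
  move=> p e Ee ee; have [hp _ [k m k0]] := shift p e Ee ee.
  by have [al _] := axP p hp; exact (shift_not_elliptic lP al m k0).
split.
  move=> p q e g Ee ee Eeg.
  have ee' : (e ^ g) * (e ^ g) <> 1 by rewrite -conjMg => /eqP; rewrite conjg_eq1 => /eqP.
  have [hp cpp [k m k0]] := shift _ _ Ee ee.
  have [hq cqq [k' m' k'0]] := shift _ _ Eeg ee'.
  have [[pl _] [ql _]] := (axP p hp, axP q hq).
  have gql : line (fun i => g * ax q i) by move=> i j; rewrite distM ql.
  (* [e] translates both [ax p] and the image of [ax q] under [g], so these lines agree and the two
     representatives lie in one class. *)
  have [eps [j [sg mu]]] := axis_unique lP pl gql m (mapsJ m') k0 k'0.
  have gm : maps g (ax q) (ax p) eps j by move=> i; have := mu i; rewrite mul1g.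
  have qp : eqv q p by split=> //; exists g, eps, j.
  have pq : p = q by rewrite -cpp -cqq; apply/esym/(canonP q hq).2.
  split=> //; subst q; apply: (QE _ _ (psi eps j)).
  by right; do 2!split=> //; exists eps, j.
move=> s t sI tI ne; have hp : hyp_pair (s, t) by [].
have [pq eqc] := canonP _ hp; have cqq := eqc _ pq.
case: pq cqq; set q := canon (s, t) => _ hq [g [eps [k [sg m]]]] cqq.
have [al [c st c0]] := axP _ hp; rewrite /= in al st.
have ts : maps (t * s) (ax (s, t)) (ax (s, t)) 1 (- (1 * c)).
  have -> : t * s = (s * t)^-1 by rewrite invgM !involV.
  exact (maps_inv lP is_sign1 st).
have c1 : (- (1 * c) <> 0)%R by rewrite mul1r; lia.
have EJ u : (exists eps k, is_sign eps /\ maps u (ax (s, t)) (ax (s, t)) eps k) ->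
    E q (u ^ g^-1).
  move=> [eps' [k' [sg' m']]]; rewrite conjgE invgK.
  have mm := maps_mul lP (maps_mul lP (maps_inv lP sg m) m') m.
  apply: QE; right; split=> //; split; first by rewrite -cqq.
  do 2!eexists; split; [|exact mm|by []].
  by rewrite is_signM // is_signM.
exists g^-1, q; split; apply: EJ; first exact: reflection_maps sI tI al st c0.
exact: reflection_maps tI sI al ts c1.
Qed.

End AxisGroups.

(** * One extension step *)

Section Morphism.
Variables (G H : groupType) (f : G -> H).
Hypothesis fM : {morph f : x y / x * y}.

Lemma morph_1 : f 1 = 1.
Proof. by apply: (mulgI (f 1)); rewrite -fM !mulg1. Qed.

Lemma morph_V x : f x^-1 = (f x)^-1.
Proof. by apply/esym/mulg1_eq; rewrite -fM mulgV morph_1. Qed.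

Lemma morph_J x y : f (x ^ y) = f x ^ f y.
Proof. by rewrite !conjgE !fM morph_V. Qed.

Lemma morph_X x n : f (x ^+ n) = f x ^+ n.
Proof. by elim: n => [|n IH]; rewrite ?expg0 ?morph_1 // !expgS fM IH. Qed.

Hypothesis f_inj : injective f.

Lemma morph_invol s : invol s -> invol (f s).
Proof.
by case=> ss s1; split; [rewrite -fM ss morph_1 | rewrite -morph_1 => /f_inj].
Qed.

Lemma morph_invol_inv s : invol (f s) -> invol s.
Proof.
case=> ss s1; split; first by apply: f_inj; rewrite fM ss morph_1.
by move=> s1'; apply: s1; rewrite s1' morph_1.
Qed.

End Morphism.

Lemma sq_conj (G : groupType) (x g : G) : x * x <> 1 -> x ^ g * x ^ g <> 1.
Proof. by move=> xx; rewrite -conjMg => /eqP; rewrite conjg_eq1 => /eqP. Qed.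

(* The subgroups [iota H] and [E i] form a family that is malnormal up to elements of
   order at most 2; the three fields [lf_malnormal*] are the cases of this. *)
Record line_family (G H : groupType) (iota : H -> G) (I : Type) (E : I -> pred G)
    (phi : I -> G -> H) : Prop := {
  lf_iotaM : {morph iota : h k / (h * k)%g};
  lf_iota_inj : injective iota;
  lf_1 : forall i, E i 1%g;
  lf_M : forall i g h, E i g -> E i h ->
    E i (g * h)%g /\ phi i (g * h)%g = (phi i g * phi i h)%g;
  lf_V : forall i g, E i g -> E i g^-1%g;
  lf_inj : forall i g h, E i g -> E i h -> phi i g = phi i h -> g = h;
  lf_malnormalH : forall h k g, (h * h)%g <> 1%g -> (iota h ^ g)%g = iota k ->
    exists a, g = iota a;
  lf_malnormalEH : forall i e h g, E i e -> (e * e)%g <> 1%g -> (e ^ g)%g <> iota h;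
  lf_malnormalE : forall i j e g, E i e -> (e * e)%g <> 1%g -> E j (e ^ g)%g ->
    i = j /\ E i g;
  lf_pairs : forall s t, invol s -> invol t -> s <> t ->
    exists g, (exists h k, (s ^ g)%g = iota h /\ (t ^ g)%g = iota k) \/
              (exists i, E i (s ^ g)%g /\ E i (t ^ g)%g) }.

Section Step.
Variables (H : groupType) (psi : int -> int -> H).
Hypothesis psiP : isom_model psi.
Hypothesis H_torsion : forall (s t : H) n, invol s -> invol t -> s <> t -> (s * t) ^+ n.+1 <> 1.
Variables (G : groupType) (iota : H -> G) (I : choiceType) (E : I -> pred G) (phi : I -> G -> H).
Hypothesis lf : line_family iota E phi.
Implicit Types (g e : G) (h k : H) (i j : I).

Lemma phi1 i : phi i 1 = 1.
Proof.
apply: (mulgI (phi i 1)); have [_ <-] := lf_M lf (lf_1 lf i) (lf_1 lf i).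
by rewrite !mulg1.
Qed.

Lemma phi_invol i (s : G) : E i s -> invol s -> invol (phi i s).
Proof.
move=> Es [ss s1]; split; first by have [_ <-] := lf_M lf Es Es; rewrite ss phi1.
by move=> p1; apply: s1; apply: (lf_inj lf Es (lf_1 lf i)); rewrite p1 phi1.
Qed.

(** After conjugation the pair lies in [iota H] or in some [E i]; both embed in [H], where
    [H_torsion] applies. *)
Lemma no_torsion (s t : G) n : invol s -> invol t -> s <> t -> (s * t) ^+ n.+1 <> 1.
Proof.
move=> sI tI st; have [g] := lf_pairs lf sI tI st.
have sgI := involJ g sI; have tgI := involJ g tI.
have stg : s ^ g <> t ^ g by move/conjg_inj.
move=> cases; suff: (s ^ g * t ^ g) ^+ n.+1 <> 1.
  by move=> ne E1; apply: ne; rewrite -conjMg -conjXg E1 conj1g.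
case: cases => [[h [k [sE tE]]]|[i [Es Et]]].
  rewrite {}sE {}tE in sgI tgI stg *; rewrite -(lf_iotaM lf) -(morph_X (lf_iotaM lf)).
  rewrite -(morph_1 (lf_iotaM lf)) => /(lf_iota_inj lf); apply: H_torsion.
  - exact: morph_invol_inv (lf_iotaM lf) (lf_iota_inj lf) _ sgI.
  - exact: morph_invol_inv (lf_iotaM lf) (lf_iota_inj lf) _ tgI.
  - by move=> hk; apply: stg; rewrite hk.
have [Est pst] := lf_M lf Es Et.
have phiX m : E i ((s ^ g * t ^ g) ^+ m) /\
    phi i ((s ^ g * t ^ g) ^+ m) = (phi i (s ^ g) * phi i (t ^ g)) ^+ m.
  elim: m => [|m [IH1 IH2]]; first by rewrite !expg0 phi1; split=> //; exact: lf_1 lf i.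
  by rewrite !expgS; have [Em ->] := lf_M lf Est IH1; rewrite pst IH2.
move=> E1; have [_] := phiX n.+1; rewrite E1 phi1 => /esym.
apply: H_torsion; [exact: phi_invol|exact: phi_invol|].
by move/(lf_inj lf Es Et).
Qed.

(* The letter (i, true) conjugates [E i] to [iota (phi i (E i))]; (i, false) is its
   inverse. *)
Definition flip (x : I * bool) := (x.1, ~~ x.2).

Definition preimage i g e := E i e && (iota (phi i e) == g).

Definition edge_group (x : I * bool) : pred G := fun g =>
  if x.2 then E x.1 g else `[< exists e, preimage x.1 g e >].

(** On a reversed letter this inverts the composite of [iota] and [phi], with the default 1 outside
    the edge group. *)
Definition edge_map (x : I * bool) g :=
  if x.2 then iota (phi x.1 g)
  else if pselect (exists e, preimage x.1 g e) is left ex then xchoose ex else 1.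

Lemma edge_mapF i e : E i e -> edge_map (i, false) (iota (phi i e)) = e.
Proof.
move=> Ee; rewrite /edge_map /=; case: pselect => [ex|[]]; last first.
  by exists e; rewrite /preimage Ee eqxx.
have /andP[Ex /eqP/(lf_iota_inj lf)] := xchooseP ex.
exact: (lf_inj lf Ex Ee).
Qed.

Lemma edge_groupF i g : edge_group (i, false) g -> exists2 e, E i e & g = iota (phi i e).
Proof. by move=> /asboolP[e /andP[Ee /eqP <-]]; exists e. Qed.

Lemma edge_groupT i e : E i e -> edge_group (i, false) (iota (phi i e)).
Proof. by move=> Ee; apply/asboolP; exists e; rewrite /preimage Ee eqxx. Qed.

Lemma step_edges : edge_system flip edge_group edge_map.
Proof.
have iM := lf_iotaM lf; have M := @lf_M _ _ _ _ _ _ lf.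
split.
- by case=> i b; rewrite /flip /= negbK.
- by case=> i [] [].
- case=> i [] /=; first exact: lf_1 lf i.
  by rewrite -(morph_1 iM) -(phi1 i); apply: edge_groupT; exact: lf_1 lf i.
- case=> i [] g h; first by move=> Eg Eh; case: (M _ _ _ Eg Eh).
  move=> /edge_groupF[e Ee ->] /edge_groupF[e' Ee' ->].
  by have [Eee' pE] := M _ _ _ Ee Ee'; rewrite -iM -pE; exact: edge_groupT.
- case=> i [] g; first by move=> Eg; exact: (lf_V lf (i := i)).
  move=> /edge_groupF[e Ee ->]; have EV := lf_V lf Ee.
  have -> : (iota (phi i e))^-1 = iota (phi i e^-1).
    by rewrite -(morph_V iM); congr iota; apply: mulg1_eq; have [_ <-] := M _ _ _ Ee EV; rewrite mulgV phi1.
  exact: edge_groupT.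
- case=> i [] g; first exact: edge_groupT.
  by move=> /edge_groupF[e Ee ->]; rewrite edge_mapF.
- case=> i [] g h; first by move=> Eg Eh; rewrite /edge_map /=; have [_ ->] := M _ _ _ Eg Eh; rewrite iM.
  move=> /edge_groupF[e Ee ->] /edge_groupF[e' Ee' ->].
  by have [Eee' pE] := M _ _ _ Ee Ee'; rewrite -iM -pE !edge_mapF.
- case=> i [] g; first by move=> Eg; rewrite /flip /= edge_mapF.
  by move=> /edge_groupF[e Ee ->]; rewrite edge_mapF.
Qed.

(** * The tree of the extension: acylindricity and the new line family *)

Local Notation es := step_edges.
Local Notation G1 := (hnn es).
Local Notation base := (base es).
Local Notation hlen := (@len _ _ _ _ _ es).
Implicit Types (u v x : G1).

Let lP : lyndon_length hlen (@common _ _ _ _ _ es) := hnn_lyndon es.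
Let iM := lf_iotaM lf.

(* An element that is not of order at most 2 and fixes an edge fixes no path that
   leaves the [iota H] end of that edge through its [E i] end. *)
Lemma fix_after_false i e w : E i e -> e * e <> 1 -> reduced es w ->
  ~~ starts_with (i, true) w -> lact es e w = w -> w = [::].
Proof.
move=> Ee ee; case: w => //= -[r [j b]] w red nst /(fix_cons red)[].
case: b red nst => red nst.
  move=> Ej _ _; have [/= ij Er] := lf_malnormalE lf Ee ee Ej.
  case/negP: nst; rewrite -ij eqxx andbT; case/and3P: red => /eqP <- _ _.
  by rewrite rep_eq1 /edge_group /= -ij.
by move=> /edge_groupF[e' _ /(lf_malnormalEH lf Ee ee)].
Qed.

(** A first letter (i, true) would put a conjugate of [iota h] into [E i], against [lf_malnormalEH].
    So the first letter is some (i, false), and [fix_after_false] ends the path there. *)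
Lemma fix_iota h r y w : h * h <> 1 -> reduced es ((r, y) :: w) ->
  lact es (iota h) ((r, y) :: w) = (r, y) :: w ->
  w = [::] /\ exists i e, [/\ E i e, e * e <> 1 & lcarry es (iota h) ((r, y) :: w) = e].
Proof.
move=> hh red /(fix_cons red)[].
have ihh : iota h * iota h <> 1 by rewrite -iM -(morph_1 iM) => /(lf_iota_inj lf).
have rr := sq_conj (g := r) ihh; move: red; case: y => i [] red Ay fw cw.
  by have := lf_malnormalEH lf Ay rr (h := h) (g := r^-1); rewrite conjgK => /(_ erefl).
have [e Ee er] := edge_groupF Ay.
have ee : e * e <> 1.
  move=> ee; apply: rr; rewrite er -iM; have [_ <-] := lf_M lf Ee Ee.
  by rewrite ee phi1 (morph_1 iM).
move: fw cw; rewrite er edge_mapF // => fw cw.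
have w0 : w = [::].
  apply: fix_after_false Ee ee _ _ fw; first by case/and3P: red.
  by case/and3P: red.
split=> //; exists i, e; split=> //.
by rewrite cw w0.
Qed.

(** Move [u] to the base vertex. If [x] has nontrivial square, a fixed path starting with (i, false)
    has length 1; one starting with (i, true) continues with an element of [iota H], so [fix_iota]
    allows at most one more edge. *)
Lemma step_acylindrical x u v : (3 <= dist hlen u v)%N ->
  dist hlen u (x * u) = 0%N -> dist hlen v (x * v) = 0%N -> x * x = 1.
Proof.
move=> d3 xu xv; apply: contrapT => xx.
have [g xuE] : exists g, x ^ u = base g by apply/len_base; move: xu; rewrite /dist conjgE.
have gg : g * g <> 1.
  move=> gg; apply: (sq_conj (g := u) xx); rewrite xuE -(baseM es) gg.
  exact: morph_1 (baseM es).
have : hlen ((base g) ^ (u^-1 * v)) = 0%N.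
  by rewrite -xuE -conjgM mulVKg conjgE -[RHS]xv /dist.
case/fix_word; move: d3; rewrite /dist.
case: (u^-1 * v) => -[w k] red; rewrite /len /= => sz fw _.
case: w red sz fw => [|[r [i b]] w] //= red sz /(fix_cons red)[].
have rr := sq_conj (g := r) gg; have red' : reduced es w by case/and3P: red.
case: b red => red; last first.
  move=> /edge_groupF[e Ee er]; rewrite er edge_mapF // => fw _.
  have ee : e * e <> 1.
    move=> ee; apply: rr; rewrite er -iM; have [_ <-] := lf_M lf Ee Ee.
    by rewrite ee phi1 (morph_1 iM).
  move: sz; rewrite (fix_after_false Ee ee red' _ fw) //; by case/and3P: red.
move=> Ei; rewrite {1}/edge_map /= => fw _.
have hh : phi i (g ^ r) * phi i (g ^ r) <> 1.
  have [Er <-] := lf_M lf Ei Ei; rewrite -(phi1 i) => /(lf_inj lf Er (lf_1 lf i)).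
  exact: rr.
case: w red' red sz fw => [|[r' y] w] red' red sz fw //.
by have [w0 _] := fix_iota hh red' fw; rewrite w0 in sz.
Qed.

Lemma elliptic_pair (s t : G1) : invol s -> invol t -> elliptic hlen (s * t) ->
  exists u s' t', [/\ invol s', invol t', s ^ u = base s' & t ^ u = base t'].
Proof.
move=> sI tI st; have [v []] := involutions_fix_common lP (proj1 sI) (proj1 tI) st.
rewrite /dist -!conjgE => /len_base[s' sE] /len_base[t' tE].
exists v, s', t'; split=> //.
  by apply: (morph_invol_inv (baseM es) (@base_inj _ _ _ _ _ es)); rewrite -sE; exact: involJ.
by apply: (morph_invol_inv (baseM es) (@base_inj _ _ _ _ _ es)); rewrite -tE; exact: involJ.
Qed.

(** If [s * t] had order at most 2 it would be elliptic, and the pair would be conjugate into the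
    base group, where [no_torsion] excludes this. *)
Lemma step_not_commute (s t : G1) : invol s -> invol t -> s <> t -> (s * t) * (s * t) <> 1.
Proof.
move=> sI tI st st2; have ell := involution_elliptic lP st2.
have [u [s' [t' [s'I t'I sE tE]]]] := elliptic_pair sI tI ell.
have st' : s' <> t' by move=> E1; apply: st; apply: (conjg_inj u); rewrite sE tE E1.
apply: (no_torsion (n := 1) s'I t'I st'); apply: (@base_inj _ _ _ _ _ es).
rewrite (morph_1 (baseM es)) (morph_X (baseM es)) (baseM es) -sE -tE.
by rewrite expg2 -conjMg -conjMg st2 conj1g.
Qed.

Definition step_iota h : G1 := base (iota h).

Lemma step_conj (s t : G) : invol s -> invol t -> s <> t ->
  exists u h k, base s ^ u = step_iota h /\ base t ^ u = step_iota k.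
Proof.
move=> sI tI st; have bJ := morph_J (baseM es).
have [g [[h [k [sE tE]]]|[i [Es Et]]]] := lf_pairs lf sI tI st.
  by exists (base g), h, k; rewrite -!bJ sE tE.
have lJ e : E i e -> base e ^ (letter es (i, true)) = step_iota (phi i e).
  move=> Ee; rewrite conjgE base_letter //.
  by rewrite mulKg.
exists (base g * letter es (i, true)), (phi i (s ^ g)), (phi i (t ^ g)).
by rewrite !conjgM -!bJ !lJ.
Qed.

Lemma step_family : exists (E1 : G1 * G1 -> pred G1) (phi1 : G1 * G1 -> G1 -> H),
  line_family step_iota E1 phi1.
Proof.
have [E1 [phi1 [P1 [PM [PV [Pinj [Pell [Pmal Ppairs]]]]]]]] :=
  axis_groups lP psiP step_acylindrical step_not_commute.
have siM : {morph step_iota : h k / h * k} by move=> h k; rewrite /step_iota iM (baseM es).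
have si_inj : injective step_iota by move=> h k /base_inj/(lf_iota_inj lf).
exists E1, phi1; split=> //.
- move=> h k u hh hu.
  have : hlen (step_iota h ^ u) = 0%N by rewrite hu.
  move=> /fix_word[fw cw]; rewrite -/(step_iota h) hu in cw.
  case: u hu fw cw => -[[|[r y] w] g] red hu fw cw.
    have uE : Hnn red = base g by exact: val_inj.
    rewrite uE -(morph_J (baseM es)) in hu *.
    by have [a ->] := lf_malnormalH lf hh (base_inj hu); exists a.
  (* A nonempty word of [u] would conjugate an element of some [E i] with nontrivial square into
     [iota H]. *)
  have [_ [i [e [Ee ee eE]]]] := fix_iota hh red fw.
  move: cw => /base_inj/esym; rewrite [(hnn_val _).1]/= eE.
  by move/(lf_malnormalEH lf Ee ee).
- move=> p e h u Ee ee eE; apply: (Pell p e Ee ee); exists u.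
  by rewrite /dist -conjgE eE.
- move=> s t sI tI st; have [ell|nell] := pselect (elliptic hlen (s * t)); last first.
    by have [g [p [Es Et]]] := Ppairs s t sI tI nell; exists g; right; exists p.
  have [u [s' [t' [s'I t'I sE tE]]]] := elliptic_pair sI tI ell.
  have st' : s' <> t' by move=> E2; apply: st; apply: (conjg_inj u); rewrite sE tE E2.
  have [v [h [k [hE kE]]]] := step_conj s'I t'I st'.
  by exists (u * v); left; exists h, k; rewrite !conjgM sE tE.
Qed.

Lemma letter_notin_iota (y : I * bool) h : letter es y <> step_iota h.
Proof. by move=> /(congr1 hlen). Qed.

End Step.

(** * The limit group *)

Section Colimit.
Variables (G : nat -> groupType) (j : forall n, G n -> G n.+1).
Hypothesis jM : forall n, {morph @j n : x y / x * y}.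
Hypothesis j_inj : forall n, injective (@j n).

Local Notation germ := {n : nat & G n}.
Definition germ_next (u : germ) : germ := Tagged G (j (tagged u)).

Lemma germ_next_inj : injective germ_next.
Proof.
move=> [n x] [m y] E.
have [nm] : n.+1 = m.+1 := congr1 tag E.
by subst m; congr Tagged; apply: j_inj; exact: eq_from_Tagged E.
Qed.

Lemma tag_iter k u : tag (iter k germ_next u) = (k + tag u)%N.
Proof. by elim: k => //= k ->. Qed.

(** Two counters are needed because the germs may start at different levels; equality of the
    dependent pairs forces them to end at the same one. *)
Definition germ_eq (u v : germ) := `[< exists k m, iter k germ_next u = iter m germ_next v >].

Lemma germ_equiv : equiv_class_of germ_eq.
Proof.
split.
- by move=> u; apply/asboolP; exists 0%N, 0%N.
- by move=> u v; apply/asboolP/asboolP => -[k [m E]]; exists m, k.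
- move=> v u w /asboolP[k [m E]] /asboolP[k' [m' E']]; apply/asboolP.
  exists (k' + k)%N, (m + m')%N.
  by rewrite iterD E -iterD addnC iterD E' -iterD.
Qed.

Canonical germ_rel := EquivRelPack germ_equiv.
Definition colimit := {eq_quot germ_rel}%qT.
HB.instance Definition _ := Choice.on colimit.
Definition colim n (x : G n) : colimit := \pi_{eq_quot germ_rel}%qT (Tagged G x).

Lemma colim_j n (x : G n) : colim (j x) = colim x.
Proof. by apply/eqquotP/asboolP; exists 0%N, 1%N. Qed.

Lemma colim_inj n : injective (@colim n).
Proof.
move=> x y /eqquotP/asboolP[k [m E]].
have := congr1 tag E; rewrite !tag_iter /= => /addIn km; subst m.
suff: Tagged G x = Tagged G y by exact: eq_from_Tagged.
by elim: k E => //= k IH /germ_next_inj.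
Qed.

Lemma colim_surj a : exists n (x : G n), a = colim x.
Proof.
exists (tag (repr a)), (tagged (repr a)); rewrite /colim.
by rewrite -[LHS]reprK; case: (repr a).
Qed.

Lemma level_map n N : (n <= N)%N ->
  exists2 f : G n -> G N, {morph f : x y / x * y} & forall x, colim (f x) = colim x.
Proof.
move=> nN; rewrite -(subnK nN); elim: (N - n)%N => [|k [f fM fP]]; first by exists id.
by exists (@j _ \o f) => [x y|x] /=; rewrite ?fM ?jM // colim_j fP.
Qed.

Lemma colim_surj3 a b c : exists n (x y z : G n), [/\ a = colim x, b = colim y & c = colim z].
Proof.
have [n1 [x ->]] := colim_surj a; have [n2 [y ->]] := colim_surj b.
have [n3 [z ->]] := colim_surj c; pose N := maxn n1 (maxn n2 n3).
have [|f _ fP] := @level_map n1 N; first by rewrite /N; lia.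
have [|g _ gP] := @level_map n2 N; first by rewrite /N; lia.
have [|h _ hP] := @level_map n3 N; first by rewrite /N; lia.
by exists N, (f x), (g y), (h z); rewrite fP gP hP.
Qed.

Lemma colim_mul_ex ab : exists c, forall n (x y : G n),
  ab.1 = colim x -> ab.2 = colim y -> c = colim (x * y).
Proof.
case: ab => a b; have [n [x [y [_ [-> -> _]]]]] := colim_surj3 a b b.
exists (colim (x * y)) => m x' y' /= xE yE.
have [f fM fP] := level_map (leq_maxl n m); have [g gM gP] := level_map (leq_maxr n m).
by rewrite -fP -gP fM gM; congr (colim (_ * _)); apply: colim_inj; rewrite fP gP.
Qed.

Definition colim_mul a b := projT1 (cid (colim_mul_ex (a, b))).

Lemma colimM n : {morph @colim n : x y / x * y >-> colim_mul x y}.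
Proof.
by move=> x y; apply/esym; rewrite /colim_mul; case: cid => c /= cP; exact: cP.
Qed.

Lemma colim_inv_ex a : exists b, forall n (x : G n), a = colim x -> b = colim x^-1.
Proof.
have [n [x ->]] := colim_surj a; exists (colim x^-1) => m y xy.
have [f fM fP] := level_map (leq_maxl n m); have [g gM gP] := level_map (leq_maxr n m).
rewrite -fP -gP (morph_V fM) (morph_V gM); congr (colim _^-1).
by apply: colim_inj; rewrite fP gP.
Qed.

Definition colim_inv a := projT1 (cid (colim_inv_ex a)).

Lemma colimV n (x : G n) : colim_inv (colim x) = colim x^-1.
Proof. by rewrite /colim_inv; case: cid => c /= cP; exact: cP. Qed.

Definition colim_one : colimit := colim (1 : G 0%N).

Lemma colim1 n : colim (1 : G n) = colim_one.
Proof. by have [f fM fP] := level_map (leq0n n); rewrite /colim_one -fP (morph_1 fM). Qed.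

Lemma colim_mulA : associative colim_mul.
Proof.
by move=> a b c; have [n [x [y [z [-> -> ->]]]]] := colim_surj3 a b c; rewrite -!colimM mulgA.
Qed.
Lemma colim_mul1g : left_id colim_one colim_mul.
Proof. by move=> a; have [n [x ->]] := colim_surj a; rewrite -(colim1 n) -colimM mul1g. Qed.
Lemma colim_mulg1 : right_id colim_one colim_mul.
Proof. by move=> a; have [n [x ->]] := colim_surj a; rewrite -(colim1 n) -colimM mulg1. Qed.
Lemma colim_mulVg : left_inverse colim_one colim_inv colim_mul.
Proof. by move=> a; have [n [x ->]] := colim_surj a; rewrite colimV -colimM mulVg colim1. Qed.
Lemma colim_mulgV : right_inverse colim_one colim_inv colim_mul.
Proof. by move=> a; have [n [x ->]] := colim_surj a; rewrite colimV -colimM mulgV colim1. Qed.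

HB.instance Definition _ := isGroup.Build colimit
  colim_mulA colim_mul1g colim_mulg1 colim_mulVg colim_mulgV.

Lemma colimit_group : exists (L : groupType) (i : forall n, G n -> L),
  [/\ forall n, {morph i n : x y / x * y}, forall n, injective (i n),
      forall n x, i n.+1 (j x) = i n x &
      forall a b, exists n (x y : G n), a = i n x /\ b = i n y].
Proof.
exists colimit, colim; split; [exact: colimM|exact: colim_inj|exact: colim_j|].
by move=> a b; have [n [x [y [_ [? ? _]]]]] := colim_surj3 a b b; exists n, x, y.
Qed.

End Colimit.

(** * The chain of extensions and its union *)

Record stage (H : groupType) := Stage {
  stage_group :> groupType;
  stage_iota : H -> stage_group;
  stage_lines : exists (E : stage_group * stage_group -> pred stage_group)
    (phi : stage_group * stage_group -> stage_group -> H), line_family stage_iota E phi }.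

Definition stage_ext (H : groupType) (S S' : stage H) (f : S -> S') :=
  [/\ {morph f : x y / x * y}, injective f,
      forall h, f (stage_iota S h) = stage_iota S' h,
      forall s t, invol s -> invol t -> s <> t ->
        exists u h k, f s ^ u = stage_iota S' h /\ f t ^ u = stage_iota S' k &
      exists x, forall h, x <> stage_iota S' h].

Section Limit.
Variables (H : groupType) (psi : int -> int -> H).
Hypothesis psiP : isom_model psi.
Hypothesis H_torsion : forall (s t : H) n, invol s -> invol t -> s <> t -> (s * t) ^+ n.+1 <> 1.

Lemma stage_ext_ex (S : stage H) : exists (S' : stage H) (f : S -> S'), stage_ext f.
Proof.
have [E [phi lf]] := stage_lines S.
exists (Stage (step_family psiP H_torsion lf)), (base (step_edges lf)); split.
- exact: baseM.
- exact: base_inj.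
- by [].
- exact: step_conj.
- by exists (letter (step_edges lf) (1, 1, true)) => h; exact: letter_notin_iota.
Qed.

Lemma trivial_family : line_family (@id H) (fun (_ : H * H) g => g == 1) (fun _ g => g).
Proof.
split=> //.
- by move=> _ g h /eqP -> /eqP ->; rewrite mul1g eqxx.
- by move=> _ g /eqP ->; rewrite invg1 eqxx.
- by move=> h k g _ _; exists g.
- by move=> _ e h g /eqP ->; rewrite mul1g.
- by move=> i j e g /eqP ->; rewrite mul1g.
- by move=> s t _ _ _; exists 1; left; exists s, t; rewrite !conjg1.
Qed.

(** Each property concerns finitely many elements, which live in one stage: malnormality is
    inherited there, and two involutions of stage n become conjugate into [H] in stage n + 1. A
    stable letter of stage 1 stays outside [H]. *)
Lemma limit_group : exists (G : groupType) (iota : H -> G),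
  [/\ {morph iota : h k / h * k}, injective iota,
      forall h k g, h * h <> 1 -> iota h ^ g = iota k -> exists a, g = iota a,
      forall s t, invol s -> invol t -> s <> t ->
        exists u h k, s ^ u = iota h /\ t ^ u = iota k &
      exists x, forall h, x <> iota h].
Proof.
pose S0 := Stage (ex_intro _ _ (ex_intro _ _ trivial_family)).
pose nxt (S : stage H) := projT1 (cid (stage_ext_ex S)).
pose S := fix S n := if n is m.+1 then nxt (S m) else S0.
pose f n : S n -> S n.+1 := projT1 (cid (projT2 (cid (stage_ext_ex (S n))))).
have fP n : stage_ext (@f n) := projT2 (cid (projT2 (cid (stage_ext_ex (S n))))).
have fM n : {morph @f n : x y / x * y} by case: (fP n).
have f_inj n : injective (@f n) by case: (fP n).
pose G : nat -> groupType := fun n => S n.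
have [L [io [ioM io_inj io_f io_surj]]] := colimit_group fM f_inj.
pose iota h := io 0%N (stage_iota (S 0%N) h).
have iotaE n h : iota h = io n (stage_iota (S n) h).
  elim: n => // n ->; have [_ _ <- _ _] := fP n; exact/esym/io_f.
have lines n := stage_lines (S n).
exists L, iota; split.
- by move=> h k; rewrite /iota -ioM.
- by move=> h k /io_inj.
- move=> h k g hh; have [n [x [_ [-> _]]]] := io_surj g g; rewrite !(iotaE n) -(morph_J (ioM n)) => /io_inj E.
  have [? [? lf]] := lines n; have [a ->] := lf_malnormalH lf hh E.
  by exists a; rewrite (iotaE n).
- move=> s t sI tI st; have [n [x [y [xE yE]]]] := io_surj s t.
  move: sI tI st; rewrite xE yE => sI tI st.
  have xI := morph_invol_inv (ioM n) (io_inj n) sI.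
  have yI := morph_invol_inv (ioM n) (io_inj n) tI.
  have xy : x <> y by move=> E; apply: st; rewrite E.
  have [_ _ _ /(_ x y xI yI xy)[u [h [k [hE kE]]]] _] := fP n.
  exists (io n.+1 u), h, k; rewrite !(iotaE n.+1) -hE -kE !(morph_J (ioM n.+1)).
  by split; congr (_ ^ _); exact/esym/io_f.
- have [_ _ _ _ [x xP]] := fP 0%N; exists (io 1%N x) => h.
  by rewrite (iotaE 1%N) => /io_inj; exact: xP.
Qed.

End Limit.

(** * The affine group and the action on involutions *)

Section Affine.
Local Open Scope ring_scope.
Variable K : fieldType.
Hypothesis hK : [pchar K] =i pred0.

Record aff := Aff { aff_val : K * K; affP : aff_val.1 != 0 }.
HB.instance Definition _ := [isSub for aff_val].
HB.instance Definition _ := [Choice of aff by <:].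
Implicit Types u v : aff.

Definition aff_one := @Aff (1, 0) (oner_neq0 K).
Definition aff_mul u v := @Aff ((aff_val u).1 * (aff_val v).1,
  (aff_val u).1 * (aff_val v).2 + (aff_val u).2) (mulf_neq0 (affP u) (affP v)).
Definition aff_inv u := @Aff ((aff_val u).1^-1, - ((aff_val u).1^-1 * (aff_val u).2))
  (invr_neq0 (affP u)).

Lemma aff_mulA : associative aff_mul.
Proof. by move=> u v w; apply: val_inj => /=; congr (_, _); ring. Qed.
Lemma aff_mul1g : left_id aff_one aff_mul.
Proof. by move=> [[a b] ?]; apply: val_inj => /=; congr (_, _); ring. Qed.
Lemma aff_mulg1 : right_id aff_one aff_mul.
Proof. by move=> [[a b] ?]; apply: val_inj => /=; congr (_, _); ring. Qed.
Lemma aff_mulVg : left_inverse aff_one aff_inv aff_mul.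
Proof. by move=> [[a b] a0]; apply: val_inj => /=; congr (_, _); field. Qed.
Lemma aff_mulgV : right_inverse aff_one aff_inv aff_mul.
Proof. by move=> [[a b] a0]; apply: val_inj => /=; congr (_, _); field. Qed.

HB.instance Definition _ := isGroup.Build aff aff_mulA aff_mul1g aff_mulg1 aff_mulVg aff_mulgV.

Definition aff_of a b : aff := insubd (1%g : aff) (a, b).

Lemma aff_ofE a b : a != 0 -> aff_val (aff_of a b) = (a, b).
Proof. by move=> a0; rewrite /aff_of -[LHS]/(val _) val_insubd /= a0. Qed.

Lemma aff_ofM a b a' b' : a != 0 -> a' != 0 ->
  (aff_of a b * aff_of a' b')%g = aff_of (a * a') (a * b' + b).
Proof.
move=> a0 a'0; apply: val_inj; by rewrite /= !aff_ofE ?mulf_neq0.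
Qed.

Lemma aff_of_inj a b a' b' : a != 0 -> a' != 0 -> aff_of a b = aff_of a' b' ->
  a = a' /\ b = b'.
Proof. by move=> a0 a'0 /(congr1 aff_val); rewrite !aff_ofE // => -[-> ->]. Qed.

Lemma natf_neq0 n : (n.+1%:R : K) != 0.
Proof. by rewrite ((pcharf0P K).1 hK). Qed.

Lemma N1_neq0 : (-1 : K) != 0.
Proof. by rewrite oppr_eq0 oner_neq0. Qed.

Lemma intrf_inj : injective (intr : int -> K).
Proof.
move=> x y /eqP; rewrite -subr_eq0 -rmorphB /= => E; apply/eqP; rewrite -subr_eq0.
case: (x - y) E => [[|n]|n] //; first by rewrite -pmulrn (negbTE (natf_neq0 n)).
by rewrite NegzE rmorphN oppr_eq0 /= -pmulrn (negbTE (natf_neq0 n)).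
Qed.

(** The isometry i |-> eps i + k read over K; characteristic 0 makes this faithful. *)
Definition aff_isom (eps k : int) : aff := aff_of eps%:~R k%:~R.

Lemma sign_neq0 (eps : int) : is_sign eps -> eps%:~R != 0 :> K.
Proof. by case/orP => /eqP ->; rewrite ?rmorphN /= ?N1_neq0 ?oner_neq0. Qed.

Lemma aff_isomP : isom_model aff_isom.
Proof.
split=> eps eps' k k' s s'.
  by rewrite aff_ofM ?sign_neq0 // /aff_isom rmorphD !rmorphM.
by move/(aff_of_inj (sign_neq0 s) (sign_neq0 s')) => -[/intrf_inj -> /intrf_inj ->].
Qed.

Lemma aff_involP u : invol u <-> exists b, u = aff_of (-1) b.
Proof.
split=> [[uu u1]|[b ->]]; last first.
  split; first by rewrite aff_ofM ?N1_neq0 //; apply: val_inj; rewrite /= aff_ofE /=; [congr (_, _); ring | rewrite mulrNN mulr1 oner_neq0].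
  move/(congr1 aff_val); rewrite aff_ofE ?N1_neq0 // => -[/eqP].
  rewrite eq_sym -subr_eq0 opprK => /eqP E _.
  by have := natf_neq0 1; rewrite mulr2n E eqxx.
case: u uu u1 => -[a b] a0 /(congr1 aff_val) [] /= aa ab u1; exists b.
apply: val_inj; rewrite /= aff_ofE ?N1_neq0 //.
have /eqP : (a - 1) * (a + 1) = 0 by rewrite mulrDr mulrBl aa; ring.
rewrite mulf_eq0 subr_eq0 addr_eq0 => /orP[/eqP a1|/eqP -> //].
case: u1; apply: val_inj => /=; congr (_, _) => //.
move: ab; rewrite a1 mul1r => /eqP; rewrite -mulr2n -mulr_natr mulf_eq0.
by rewrite (negbTE (natf_neq0 1)) orbF => /eqP.
Qed.

Lemma aff_translation b b' n : ((aff_of (-1) b * aff_of (-1) b') ^+ n)%g = aff_of 1 (n%:R * (b - b')).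
Proof.
rewrite aff_ofM ?N1_neq0 //; have -> : -1 * -1 = 1 :> K by ring.
have -> : -1 * b' + b = b - b' by ring.
elim: n => [|n IH].
  by apply: val_inj; rewrite expg0 /= aff_ofE ?oner_neq0 // mul0r.
rewrite expgS IH aff_ofM ?oner_neq0 // mulr1; congr aff_of.
by rewrite -natr1; ring.
Qed.

Lemma aff_torsion u v n : invol u -> invol v -> u <> v -> ((u * v) ^+ n.+1)%g <> 1%g.
Proof.
move=> /aff_involP[b ->] /aff_involP[b' ->] uv; rewrite aff_translation => /(congr1 aff_val).
rewrite aff_ofE ?oner_neq0 // => -[/eqP]; rewrite mulf_eq0 (negbTE (natf_neq0 n)) subr_eq0.
by move=> /eqP bb; apply: uv; rewrite bb.
Qed.

Lemma aff_conj b c d : c != 0 -> (aff_of (-1) b ^ aff_of c d)%g = aff_of (-1) ((b - 2%:R * d) / c).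
Proof.
move=> c0; apply: (mulgI (aff_of c d)); rewrite conjgE mulVKg.
rewrite !aff_ofM ?N1_neq0 //; congr aff_of; first by ring.
by field.
Qed.

Lemma aff_2_transitive u v : invol u -> invol v -> u <> v ->
  exists w, (u ^ w)%g = aff_of (-1) 0 /\ (v ^ w)%g = aff_of (-1) 1.
Proof.
move=> /aff_involP[b ->] /aff_involP[b' ->] uv.
have bb : b' - b != 0 by rewrite subr_eq0; apply/eqP => E; apply: uv; rewrite E.
have two : (2%:R : K) != 0 := natf_neq0 1.
(* The involution x |-> b - x has centre b/2. This affine map carries the centres 0 and 1/2 of the
   target involutions to b/2 and b'/2. *)
by exists (aff_of (b' - b) (b / 2%:R)); rewrite !aff_conj //; split; congr aff_of; field;
   rewrite ?two ?bb.
Qed.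

Lemma aff_free w : (aff_of (-1) 0 ^ w)%g = aff_of (-1) 0 ->
  (aff_of (-1) 1 ^ w)%g = aff_of (-1) 1 -> w = 1%g.
Proof.
have -> : w = aff_of (aff_val w).1 (aff_val w).2.
  by apply: val_inj; rewrite /= aff_ofE ?affP //; case: (aff_val w).
have := affP w; case: (aff_val w) => c d /= c0; rewrite !aff_conj //.
have two : (2%:R : K) != 0 := natf_neq0 1.
move=> /(aff_of_inj N1_neq0 N1_neq0)[_ /eqP]; rewrite sub0r mulf_eq0 invr_eq0 (negbTE c0) orbF.
rewrite oppr_eq0 mulf_eq0 (negbTE two) => /eqP ->.
move=> /(aff_of_inj N1_neq0 N1_neq0)[_ /eqP]; rewrite mulr0 subr0 div1r invr_eq1 => /eqP ->.
by apply: val_inj; rewrite /= aff_ofE // oner_neq0.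
Qed.

End Affine.

(** * The conjugation action on involutions *)

Section InvolutionAction.
Variables (K : fieldType) (G : groupType) (iota : aff K -> G).
Hypothesis hK : ([pchar K] =i pred0)%R.
Hypothesis iM : {morph iota : h k / h * k}.
Hypothesis i_inj : injective iota.
Hypothesis malnormal : forall (h k : aff K) (g : G), h * h <> 1 -> iota h ^ g = iota k -> exists a, g = iota a.
Hypothesis pairs : forall s t, invol s -> invol t -> s <> t ->
  exists u h k, s ^ u = iota h /\ t ^ u = iota k.
Hypothesis proper : exists x, forall h, x <> iota h.
Implicit Types (g h s t u x : G).

Let s0 : aff K := aff_of (-1) 0.
Let t0 : aff K := aff_of (-1) 1.

Let s0I : invol s0. Proof. by apply/(aff_involP hK); exists 0%R. Qed.
Let t0I : invol t0. Proof. by apply/(aff_involP hK); exists 1%R. Qed.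
Let s0t0 : s0 <> t0.
Proof.
move=> /(aff_of_inj (N1_neq0 K) (N1_neq0 K))[_ /esym/eqP].
by rewrite (negbTE (oner_neq0 K)).
Qed.

Lemma pair_to_base s t : invol s -> invol t -> s <> t ->
  exists u, s ^ u = iota s0 /\ t ^ u = iota t0.
Proof.
move=> sI tI st; have [u [h [k [sE tE]]]] := pairs sI tI st.
have hI : invol h by apply: (morph_invol_inv iM i_inj); rewrite -sE; exact: involJ.
have kI : invol k by apply: (morph_invol_inv iM i_inj); rewrite -tE; exact: involJ.
have hk : h <> k by move=> E; apply: st; apply: (conjg_inj u); rewrite sE tE E.
have [w [hE kE]] := aff_2_transitive hK hI kI hk.
by exists (u * iota w); rewrite !conjgM sE tE -!(morph_J iM) hE kE.
Qed.

Lemma translation_sq : (s0 * t0) * (s0 * t0) <> 1.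
Proof. by have := @aff_torsion _ hK _ _ 1 s0I t0I s0t0; rewrite expg2. Qed.

(** After moving the pair to [iota s0], [iota t0], the conjugate of [g] centralizes the translation
    [iota (s0 * t0)], so malnormality puts it into the affine group, where [aff_free] applies. *)
Lemma pair_free g s t : invol s -> invol t -> s <> t -> s ^ g = s -> t ^ g = t -> g = 1.
Proof.
move=> sI tI st sg tg; have [u [sE tE]] := pair_to_base sI tI st.
have s1 : iota s0 ^ (g ^ u) = iota s0 by rewrite -sE -conjJg sg.
have t1 : iota t0 ^ (g ^ u) = iota t0 by rewrite -tE -conjJg tg.
have [a aE] : exists a, g ^ u = iota a.
  by apply: (malnormal (k := s0 * t0) translation_sq); rewrite iM conjMg s1 t1.
rewrite aE -(morph_J iM) in s1; rewrite aE -(morph_J iM) in t1.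
have a1 := aff_free hK (i_inj s1) (i_inj t1).
by apply/eqP; rewrite -(conjg_eq1 _ u) aE a1 (morph_1 iM).
Qed.

Lemma pair_torsion s t n : invol s -> invol t -> s <> t -> (s * t) ^+ n.+1 <> 1.
Proof.
move=> sI tI st; have [u [sE tE]] := pair_to_base sI tI st.
move=> /(congr1 (conjg^~ u)); rewrite conjXg conjMg sE tE conj1g -iM -(morph_X iM).
by rewrite -(morph_1 iM) => /i_inj; exact: aff_torsion.
Qed.

Definition involution := {s : G | (s * s == 1) && (s != 1)}.

Lemma involutionP (x : involution) : invol (val x).
Proof. by case: x => s /= /andP[/eqP ss /eqP s1]. Qed.

Lemma involb s : invol s -> (s * s == 1) && (s != 1).
Proof. by case=> -> s1; rewrite eqxx; apply/eqP. Qed.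

Definition to_involution s (sI : invol s) : involution := exist _ s (involb sI).

(** The inverse turns conjugation, a right action, into a left action. *)
Definition act g (x : involution) := to_involution (involJ g^-1 (involutionP x)).

Lemma act1 : act 1 = id.
Proof. by apply: funext => x; apply: val_inj; rewrite /= invg1 conjg1. Qed.

Lemma actM g h : act (g * h) = act g \o act h.
Proof. by apply: funext => x; apply: val_inj; rewrite /= invgM conjgM. Qed.

Lemma actV g : act g^-1 \o act g = id /\ act g \o act g^-1 = id.
Proof. by rewrite -!actM mulVg mulgV act1. Qed.

Lemma val_neq (x y : involution) : x <> y -> val x <> val y.
Proof. by move=> xy /val_inj. Qed.

Lemma act_free g h (x y : involution) : x <> y -> act g x = act h x -> act g y = act h y -> g = h.
Proof.
move=> /val_neq xy gx gy; have [xI yI] := (involutionP x, involutionP y).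
have fixed (z : involution) : act g z = act h z -> val z ^ (g^-1 * h) = val z.
  by move=> /(congr1 val) /= E; rewrite conjgM E conjgKV.
by apply/esym; have /mulg1_eq := pair_free xI yI xy (fixed x gx) (fixed y gy); rewrite invgK.
Qed.

Let x0 := to_involution (morph_invol iM i_inj s0I).
Let y0 := to_involution (morph_invol iM i_inj t0I).
Let x0y0 : x0 <> y0. Proof. by move=> /(congr1 val) /= /i_inj. Qed.

Lemma act_inj : injective act.
Proof. by move=> g h E; apply: (act_free x0y0); rewrite E. Qed.

Lemma pair_transitive s t s' t' : invol s -> invol t -> s <> t ->
  invol s' -> invol t' -> s' <> t' -> exists u, s ^ u = s' /\ t ^ u = t'.
Proof.
move=> sI tI st s'I t'I st'; have [u [sE tE]] := pair_to_base sI tI st.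
have [v [s'E t'E]] := pair_to_base s'I t'I st'.
by exists (u * v^-1); rewrite !conjgM sE tE -s'E -t'E !conjgK.
Qed.

Definition act_image (f : involution -> involution) := exists g, f = act g.

Lemma act_sharply_2_transitive : sharply_2_transitive act_image.
Proof.
split; last split.
- split; first by exists 1; rewrite act1.
  split; first by move=> _ _ [g ->] [h ->]; exists (g * h); rewrite actM.
  by move=> _ [g ->]; exists (act g^-1); [exists g^-1 | exact: actV].
- by exists x0, y0.
- move=> x y x' y' /[dup] xy /val_neq vxy /val_neq xy'.
  have [u [xu yu]] := pair_transitive (involutionP x) (involutionP y) vxy
    (involutionP x') (involutionP y') xy'.
  have ux : act u^-1 x = x' by apply: val_inj; rewrite /= invgK.
  have uy : act u^-1 y = y' by apply: val_inj; rewrite /= invgK.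
  exists (act u^-1); split; first by split=> //; exists u^-1.
  by move=> _ [g ->] gx gy; congr act; apply: (act_free xy); rewrite ?gx ?gy.
Qed.

Lemma act_involution f : involution_in act_image f -> exists2 g, f = act g & invol g.
Proof.
case=> [[g ->] [g1 gg]]; exists g => //; split; last by move=> E; apply: g1; rewrite E act1.
by apply: act_inj; rewrite actM gg act1.
Qed.

(** An involution fixes itself as a point; infinite order is [pair_torsion] seen through the
    faithful action. *)
Lemma act_char0 : s2t_char0 act_image.
Proof.
split.
  move=> _ /act_involution[g -> gI]; exists (to_involution gI); apply: val_inj => /=.
  by rewrite conjgE invgK mulgV mulg1.
move=> _ _ /act_involution[g -> gI] /act_involution[h -> hI] gh [//|n] _.
have gh' : g <> h by move=> E; apply: gh; rewrite E.
rewrite -actM => E; apply: (pair_torsion (n := n) gI hI gh'); apply: act_inj.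
rewrite act1 -E; elim: n.+1 => [|m IH]; first by rewrite expg0 act1.
by rewrite expgS [LHS]actM IH.
Qed.

Definition act_aff (a b : K) : involution -> involution := act (iota (aff_of a b)).

Lemma act_aff_embeds : AGL1_embeds act_image act_aff.
Proof.
split; first by move=> a b _; exists (iota (aff_of a b)).
split; first by move=> a b a' b' a0 a'0; rewrite -actM -iM aff_ofM.
by move=> a b a' b' a0 a'0 /act_inj/i_inj/(aff_of_inj a0 a'0).
Qed.

Lemma act_nonsplit : ~ exists N, regular_normal_subgroup act_image N.
Proof.
case=> N [NG [[N1 [NM NV]] [Nnorm Nreg]]].
pose P g := N (act g).
have PM g h : P g -> P h -> P (g * h) by rewrite /P actM; exact: NM.
have PJ g x : P g -> P (g ^ x).
  move=> Pg; have := Nnorm (act x^-1) (act x) (act g) (ex_intro _ _ erefl)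
    (ex_intro _ _ erefl) (actV x).2 Pg.
  by rewrite /P conjgE !actM.
have PV g : P g -> P g^-1.
  move=> /NV[h Nh [hg _]].
  have : h \o (act g \o act g^-1) = act g^-1.
    by rewrite -[LHS]/((h \o act g) \o act g^-1) hg.
  by rewrite (actV g).2 /P => <-.
have Psame s g h : invol s -> P g -> P h -> s ^ g^-1 = s ^ h^-1 -> g = h.
  move=> sI Pg Ph gh; apply: act_inj.
  have [n [_ nU]] := Nreg (to_involution sI) (act g (to_involution sI)).
  by rewrite (nU _ Pg) // (nU _ Ph) //; apply: val_inj; rewrite /= gh.
have P1 : P 1 by rewrite /P act1.
(* Regularity gives g in N with t = g s g^-1; then t s is the product of g and the conjugate of g^-1
   by s. *)
have Ptrans s t : invol s -> invol t -> P (t * s).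
  move=> sI tI; have [n [[Nn nst] _]] := Nreg (to_involution sI) (to_involution tI).
  have [g gE] := NG n Nn; have Pg : P g by rewrite /P -gE.
  have tE : s ^ g^-1 = t by move: nst; rewrite gE => /(congr1 val).
  have -> : t * s = g * (g^-1 ^ s).
    by rewrite -tE !conjgE invgK (involV sI) -!mulgA.
  by apply: PM => //; apply: PJ; exact: PV.
(* If g moves s to u, take t exchanging s and u. It is an involution since its square fixes both,
   and [t * s] is in N and also moves s to u, so g = t s, which s inverts. *)
have Pinv s g : invol s -> P g -> g ^ s = g^-1.
  move=> sI Pg; have [E|ne] := EM (s ^ g^-1 = s).
    have -> : g = 1 by apply: (Psame s) => //; rewrite E invg1 conjg1.
    by rewrite conj1g invg1.
  have uI := involJ g^-1 sI; set u := s ^ g^-1 in ne uI.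
  have [t [su us]] := pair_transitive sI uI (fun E => ne (esym E)) uI sI ne.
  have tt : t * t = 1.
    by apply: (pair_free sI uI (fun E => ne (esym E))); rewrite conjgM ?su ?us.
  have tI : invol t by split=> // t1; apply: ne; rewrite -su t1 conjg1.
  have gE : g = t * s.
    apply: (Psame s) => //; first exact: Ptrans.
    have ss : s ^ s = s by rewrite conjgE mulKg.
    by rewrite -/u invgM !involV // conjgM ss su.
  by rewrite gE conjgE -!mulgA (proj1 sI) mulg1 invgM (involV tI).
have Pcomm g h : P g -> P h -> g ^ h = g.
  move=> Pg Ph; have sI := morph_invol iM i_inj s0I.
  have := Pinv _ _ sI (PM _ _ Pg Ph); rewrite conjMg !(Pinv _ _ sI) // => /(congr1 (fun z => z^-1)).
  by rewrite !invgM !invgK conjgE => <-; rewrite mulKg.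
have [x xP] := proper.
have Pst : P (iota (s0 * t0)).
  by rewrite iM; apply: Ptrans; [exact: morph_invol t0I | exact: morph_invol s0I].
(* The translation commutes with its conjugate by [x]: a first use of malnormality puts that
   conjugate into the affine group, a second puts [x] there. *)
have [a aE] := malnormal translation_sq (Pcomm _ _ Pst (PJ _ x Pst)).
by have [b xb] := malnormal translation_sq aE; exact: xP xb.
Qed.

End InvolutionAction.

Local Open Scope ring_scope.

Theorem theorem1p1 (K : fieldType) (hK : [pchar K] =i pred0) :
  exists (X : Type) (G : (X -> X) -> Prop) (phi : K -> K -> (X -> X)),
    sharply_2_transitive G /\ s2t_char0 G /\ AGL1_embeds G phi /\
    ~ (exists N, regular_normal_subgroup G N).
Proof.
have [G [iota [iM i_inj mal pairs proper]]] := limit_group (aff_isomP hK) (@aff_torsion _ hK).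
exists (involution G), (@act_image G), (act_aff iota); split.
  exact: act_sharply_2_transitive hK iM i_inj mal pairs.
split; first exact: act_char0 hK iM i_inj mal pairs.
split; first exact: act_aff_embeds hK iM i_inj mal pairs.
exact: act_nonsplit hK iM i_inj mal pairs proper.
Qed.
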